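(* Let $p\ge0$ and, for $i=1,\dots,p$, let $J_{\lambda_i}(2n_{i1},\dots,2n_{is_i})$ be Jordan tuples with positive integers $n_{i1}\ge\dots\ge n_{is_i}$. There exists a finite-dimensional complex Lie algebra whose Jordan–Kronecker invariants consist exactly of these Jordan tuples and no Kronecker blocks if and only if each of these Jordan tuples has a unique maximum, i.e. $s_i=1$ or $n_{i1}>n_{i2}$ for every $i$.
   Context: For a finite-dimensional complex Lie algebra $\mathfrak g$ and $x\in\mathfrak g^*$, let $\mathcal A_x$ be the skew form $(\xi,\eta)\mapsto\langle x,[\xi,\eta]\rangle$ on $\mathfrak g$. By the Jordan–Kronecker theorem, a pair of skew forms on a finite-dimensional complex vector space admits a basis in which both are block-diagonal with blocks of types: Jordan $2n\times2n$ blocks with an eigenvalue $\mu\in\mathbb C\cup\{\infty\}$ ($A_i=\begin{pmatrix}0&J_\mu\\-J_\mu^T&0\end{pmatrix}$, $B_i=\begin{pmatrix}0&I_n\\-I_n&0\end{pmatrix}$, roles swapped for $\infty$), and Kronecker $(2k-1)\times(2k-1)$ blocks ($k\ge1$); block data grouped by eigenvalue are unique. The JK invariants of $\mathfrak g$ are, for $(x,a)$ in a nonempty Zariski open subset of $\mathfrak g^*\times\mathfrak g^*$ (where these data are constant), the Kronecker sizes $2k-1$ of the Kronecker blocks of $(\mathcal A_x,\mathcal A_a)$ and, for each distinct eigenvalue $\lambda_i$, the Jordan tuple $J_{\lambda_i}(2n_{i1},\dots,2n_{is_i})$ of sizes of Jordan blocks with eigenvalue $\lambda_i$ (eigenvalues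 regarded as distinct formal symbols; the data form a multiset). *)

(* Defs.v *)
From mathcomp Require Import all_boot all_algebra.
From mathcomp Require Import complex.
From mathcomp Require Import Rstruct.
From mathcomp Require mpoly.

Set Implicit Arguments.
Unset Strict Implicit.
Unset Printing Implicit Defensive.
Import GRing.Theory.
Local Open Scope ring_scope.

Definition C : closedFieldType := complex.complex Rdefinitions.R.

Record lie_algebra (n : nat) := LieAlgebra {
  lie_br : 'rV[C]_n -> 'rV[C]_n -> 'rV[C]_n;
  lie_br_linl : forall (c : C) x y z, lie_br (c *: x + y) z = c *: lie_br x z + lie_br y z;
  lie_br_linr : forall (c : C) x y z, lie_br z (c *: x + y) = c *: lie_br z x + lie_br z y;
  lie_br_alt : forall x, lie_br x x = 0;
  lie_br_jacobi : forall x y z,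
    lie_br x (lie_br y z) + lie_br y (lie_br z x) + lie_br z (lie_br x y) = 0
}.

Definition basis_vec n (i : 'I_n) : 'rV[C]_n := delta_mx 0 i.

(* Elements of g^* are row vectors x, with pairing <x, v> = sum_k x_k v_k. *)
Definition pairing n (x v : 'rV[C]_n) : C := \sum_k x 0 k * v 0 k.

Definition form_A n (g : lie_algebra n) (x : 'rV[C]_n) : 'M[C]_n :=
  \matrix_(i, j) pairing x (lie_br g (basis_vec i) (basis_vec j)).

(* [JKJordan mu m] : Jordan block of size 2m, eigenvalue mu, where
   mu = Some l is the finite eigenvalue l and mu = None is infinity.
   [JKKron k] : Kronecker block of size 2k-1.                           *)
Inductive jkblock :=
| JKJordan of option C & nat
| JKKron of nat.

Definition jk_size (b : jkblock) : nat :=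
  match b with
  | JKJordan _ m => 2 * m
  | JKKron k => (2 * k).-1
  end%N.

Definition jk_valid (b : jkblock) : bool :=
  match b with
  | JKJordan _ m => 0 < m
  | JKKron k => 0 < k
  end%N.

Definition jordan_entry (l : C) (i j : nat) : C :=
  if i == j then l else if j == i.+1 then 1 else 0.

(* Entries of the 2m x 2m skew matrix [[0, M], [-M^T, 0]] where M is
   given by its entry function. *)
Definition skew_of (m : nat) (M : nat -> nat -> C) (i j : nat) : C :=
  if ((i < m) && (m <= j))%N then M i (j - m)%N
  else if ((m <= i) && (j < m))%N then - M j (i - m)%N
  else 0.

Definition id_entry (i j : nat) : C := if i == j then 1 else 0.

(* Kronecker block of size 2k-1: the first k indices and the last k-1
   indices; A has off-diagonal k x (k-1) block [I_(k-1); 0] and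
   B has off-diagonal block [0; I_(k-1)]. *)
Definition kronA_entry (i j : nat) : C := if i == j then 1 else 0.
Definition kronB_entry (i j : nat) : C := if i == j.+1 then 1 else 0.

Definition blockA (b : jkblock) : nat -> nat -> C :=
  match b with
  | JKJordan (Some l) m => skew_of m (jordan_entry l)
  | JKJordan None m => skew_of m id_entry
  | JKKron k => skew_of k kronA_entry
  end.

Definition blockB (b : jkblock) : nat -> nat -> C :=
  match b with
  | JKJordan (Some l) m => skew_of m id_entry
  | JKJordan None m => skew_of m (jordan_entry 0)
  | JKKron k => skew_of k kronB_entry
  end.

Fixpoint blockdiag (f : jkblock -> nat -> nat -> C) (s : seq jkblock)
    (i j : nat) : C :=
  match s with
  | [::] => 0
  | b :: s' =>
      let m := jk_size b in
      if ((i < m) && (j < m))%N then f b i j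
      else if ((m <= i) && (m <= j))%N then blockdiag f s' (i - m)%N (j - m)%N
      else 0
  end.

Definition blockdiag_mx n (f : jkblock -> nat -> nat -> C) (s : seq jkblock)
  : 'M[C]_n := \matrix_(i, j) blockdiag f s i j.

Definition JK_decomposition n (A B : 'M[C]_n) (s : seq jkblock) : Prop :=
  all jk_valid s /\ (\sum_(b <- s) jk_size b)%N = n /\
  exists P : 'M[C]_n, P \in unitmx /\
    P *m A *m P^T = blockdiag_mx n blockA s /\
    P *m B *m P^T = blockdiag_mx n blockB s.

Definition kron_sizes (s : seq jkblock) : seq nat :=
  [seq jk_size b | b <- s & if b is JKKron _ then true else false].

Definition jordan_eigs (s : seq jkblock) : seq (option C) :=
  undup [seq (if b is JKJordan mu _ then mu else None) |
          b <- s & if b is JKJordan _ _ then true else false].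

Definition jordan_tuple (s : seq jkblock) (mu : option C) : seq nat :=
  sort geq [seq jk_size b | b <- s &
            if b is JKJordan mu' _ then mu' == mu else false].

(* The Jordan tuples, one for each distinct eigenvalue (eigenvalues
   forgotten: regarded as formal symbols). *)
Definition jordan_tuples (s : seq jkblock) : seq (seq nat) :=
  [seq jordan_tuple s mu | mu <- jordan_eigs s].

(* Zariski topology on g^* x g^* = C^(n+n): basic open sets D(fs) are
   the points where some polynomial of the finite family fs is nonzero
   (every Zariski open set is of this form). *)
Definition point n (x a : 'rV[C]_n) : 'I_(n + n) -> C :=
  fun i => row_mx x a 0 i.

Definition zariski_open n (U : 'rV[C]_n -> 'rV[C]_n -> Prop) : Prop :=
  exists fs : seq (mpoly.mpoly (n + n) C),
    forall x a, U x a <-> has (fun f => mpoly.meval (point x a) f != 0) fs.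

Definition JK_invariants n (g : lie_algebra n) (K : seq nat) (T : seq (seq nat))
  : Prop :=
  exists U : 'rV[C]_n -> 'rV[C]_n -> Prop,
    zariski_open U /\ (exists x a, U x a) /\
    forall x a, U x a ->
      exists s, JK_decomposition (form_A g x) (form_A g a) s /\
        perm_eq (kron_sizes s) K /\ perm_eq (jordan_tuples s) T.

(* Main.v *)
(* No Kronecker blocks means that the form A_x is invertible for generic x. Its
   inverse is a closed rational 2-form w on the dual of the Lie algebra. Along the
   divisor of poles {q = 0} write w = s / q^n; then dw = 0 gives dq /\ s = 0 modulo
   q, so the leading coefficient s has rank two there. On a generic line x - l a
   this rank is twice the number of Jordan blocks of maximal size n for the given
   eigenvalue, so the maximal block is unique.

   Conversely, let H be a commutative algebra and g the semidirect product of the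
   abelian Lie algebra H with its dual module. The Jordan structure of the pencil
   (A_x, A_a) is that of multiplication by x / a in H. For one tuple
   n_1 > n_2 >= ... take H = C[t]/t^n_1 + sum_(i > 1) C[t]/t^n_i, the other summands
   forming an ideal of square zero: since n_i < n_1, a generic nilpotent element has
   Jordan blocks n_1, n_2, ... Several tuples are realized by the product algebra. *)
Require Import Defs.
From mathcomp Require Import all_boot all_algebra.
From mathcomp Require Import perm complex Rstruct ring zify.
From mathcomp Require Import mpoly.
Set Implicit Arguments.
Unset Strict Implicit.
Unset Printing Implicit Defensive.
Import GRing.Theory.
Local Open Scope ring_scope.

(** * Derivations and poles of closed forms *)

(** The poles are studied in [{poly R}], where [R] consists of the polynomials in [x] and ['X] is
    the parameter l of the line. The divisor is never factored: the squarefree part m / gcd(m, m')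
    of the denominator [m] replaces q, which treats all eigenvalues and pole orders at once. Two
    facts make this possible. Every derivation maps [m] to a multiple of gcd(m, m'), so dm can be
    divided by it; and the pencil depends on x - l a only, so the derivative along (a, 1)
    annihilates it, which makes the contraction of the divided dm with [a] invertible at the poles.
    Divisibility in [{poly R}] holds up to scalars of [R]; where their product is nonzero, the
    identities survive the substitution of numbers for [x]. The rank at an eigenvalue is not
    computed. For two equal maximal blocks, decomposability annihilates a corner entry of the
    inverse that should carry the full pole; then the whole numerator vanishes at that pole,
    although the fraction is in lowest terms. *)

Definition derivation (A : nzRingType) (D : A -> A) : Prop :=
  {morph D : x y / x + y} /\ forall x y, D (x * y) = D x * y + x * D y.

(** * Divisibility up to scalars, and derivations of polynomials *)

Section PseudoDivision.
Import Pdiv.Idomain.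
Variable R : idomainType.
Implicit Types p q g : {poly R}.

(** Pseudo-division of each [f i] costs its own power of the leading coefficient of [g]; multiplying
    by the powers of the other indices makes the scalar uniform. *)
Lemma common_cofactor (I : finType) (f : I -> {poly R}) g :
    (forall i, g %| f i) ->
  exists2 c, c != 0 & exists q : I -> {poly R}, forall i, c *: f i = q i * g.
Proof.
move=> gf; pose k i := lead_coef g ^+ scalp (f i) g.
have k0 i : k i != 0 by apply: lc_expn_scalp_neq0.
exists (\prod_i k i); first by apply/prodf_neq0 => i _.
exists (fun i => (\prod_(j | j != i) k j) *: (f i %/ g)) => i.
by rewrite -scalerAl divpK // scalerA mulrC (bigD1 i).
Qed.

(** The combination is a gcd of the family, obtained by adding one member at a time with [Bezoutp].
    Being a combination, it leaves quotients that generate a nonzero scalar. *)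
Lemma bezout_family (I : finType) (p : I -> {poly R}) :
  exists u : I -> {poly R}, forall i, (\sum_j u j * p j) %| p i.
Proof.
suff [u uP] : exists u : I -> {poly R},
    forall i, i \in enum I -> (\sum_j u j * p j) %| p i.
  by exists u => i; apply: uP; rewrite mem_enum.
elim: (enum I) => [|i s [u uP]]; first by exists (fun=> 0).
have [v] := Bezoutp (p i) (\sum_j u j * p j).
rewrite /eqp => /andP[v1 v2].
exists (fun j => v.1 * (j == i)%:R + v.2 * u j) => k.
have -> : \sum_j (v.1 * (j == i)%:R + v.2 * u j) * p j =
    v.1 * p i + v.2 * \sum_j u j * p j.
  under eq_bigr do rewrite mulrDl; rewrite big_split /= mulr_sumr; congr (_ + _).
    rewrite (bigD1 i) //= eqxx mulr1 big1 ?addr0 // => j /negPf ->.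
    by rewrite mulr0 mul0r.
  by apply: eq_bigr => j _; rewrite mulrA.
rewrite inE => /predU1P[->|ks]; first exact: dvdp_trans v1 (dvdp_gcdl _ _).
exact: dvdp_trans (dvdp_trans v1 (dvdp_gcdr _ _)) (uP _ ks).
Qed.

Hypothesis char0 : forall k, k.+1%:R != 0 :> R.

Lemma deriv_neq0 p : (1 < size p)%N -> p^`() != 0.
Proof.
case E: (size p) => [|[|k]] // _; apply/eqP => /(congr1 (fun q => q`_k)).
rewrite coef_deriv coef0 => /eqP; rewrite -mulr_natr mulf_eq0 (negPf (char0 _)) orbF.
by rewrite -[k.+1]/(k.+2.-1) -E -/(lead_coef p) lead_coef_eq0 -size_poly_eq0 E.
Qed.

(* If [m = prod (l - l_i)^n_i] then [gcdp m m' = prod (l - l_i)^(n_i - 1)], and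
   [D m] contains this factor also when the roots move along [D]. *)
Lemma gcdp_deriv_dvd (D : {poly R} -> {poly R}) :
  derivation D -> forall m, gcdp m m^`() %| D m.
Proof.
case=> DD DM m; have [k] := ubnP (size m); elim: k m => // k IHk m.
rewrite ltnS => mk; have D0 : D 0 = 0.
  by apply: (addrI (D 0)); rewrite -DD !addr0.
have [m1|m1] := leqP (size m) 1.
  have [->|m0] := eqVneq m 0; first by rewrite D0 dvdp0.
  have /size_poly1P[c c0 ->] : size m == 1%N.
    by rewrite eqn_leq m1 lt0n size_poly_eq0.
  rewrite derivC gcdp0 -[c%:P]mulr1 mul_polyC dvdpZl //; exact: dvd1p.
have m0 : m != 0 by rewrite -size_poly_gt0 ltnW.
have m'0 := deriv_neq0 m1.
set g := gcdp m _; pose r := m %/ g; pose s := m^`() %/ g.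
have g0 : g != 0 by rewrite gcdp_eq0 negb_and m0.
have [c1 c10 E1] : exists2 c, c != 0 & c *: m = r * g.
  by exists (lead_coef g ^+ scalp m g); rewrite ?divpK ?dvdp_gcdl ?lc_expn_scalp_neq0.
have [c2 c20 E2] : exists2 c, c != 0 & c *: m^`() = s * g.
  exists (lead_coef g ^+ scalp m^`() g); first exact: lc_expn_scalp_neq0.
  by rewrite divpK ?dvdp_gcdr.
have gk : (size g < k)%N.
  apply: leq_trans mk; apply: leq_ltn_trans (lt_size_deriv m0).
  by rewrite dvdp_leq ?dvdp_gcdr.
have IH := IHk _ gk.
pose g2 := gcdp g g^`(); pose r2 := g %/ g2; pose s2 := g^`() %/ g2.
have g20 : g2 != 0 by rewrite gcdp_eq0 negb_and g0.
have [c3 c30 E3] : exists2 c, c != 0 & c *: g = r2 * g2.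
  by exists (lead_coef g2 ^+ scalp g g2); rewrite ?divpK ?dvdp_gcdl ?lc_expn_scalp_neq0.
have [c4 c40 E4] : exists2 c, c != 0 & c *: g^`() = s2 * g2.
  exists (lead_coef g2 ^+ scalp g^`() g2); first exact: lc_expn_scalp_neq0.
  by rewrite divpK ?dvdp_gcdr.
have co2 : coprimep r2 s2 by apply: coprimep_div_gcd; rewrite g0.
(* The squarefree part of [g] divides that of [m]: up to scalars, differentiating m = r g gives r s2
   = r2 (s - r'), and [r2] is coprime to [s2]. *)
have r2r : r2 %| r.
  rewrite -(Gauss_dvdpl r co2) -(dvdpZr _ _ (mulf_neq0 c20 c30)).
  apply/dvdpP; exists (1, c4 *: (c1 *: s - c2 *: r^`())); first exact: oner_neq0.
  rewrite scale1r /=; apply: (mulIf g20); apply: (mulIf g0).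
  have E5 : g * (c1 *: s - c2 *: r^`()) = c2 *: (r * g^`()).
    have := congr1 deriv E1; rewrite derivZ derivM => /(congr1 (fun p => c2 *: p)).
    rewrite scalerA mulrC -scalerA E2 => E; rewrite mulrBr.
    rewrite -scalerAr mulrC E; rewrite -!mul_polyC; ring.
  transitivity (g * (c2 *: (r * (c3 *: (s2 * g2))))).
    by rewrite -!mul_polyC !polyCM; ring.
  rewrite -E4.
  transitivity (c3 *: (c4 *: (g * (c2 *: (r * g^`()))))).
    by rewrite -!mul_polyC; ring.
  rewrite -E5.
  transitivity (c4 *: ((c3 *: g) * (g * (c1 *: s - c2 *: r^`())))).
    by rewrite -!mul_polyC; ring.
  rewrite E3; rewrite -!mul_polyC; ring.
(* In D(r g) = D(r) g + r D(g) the last term is divisible by r2 g2, that is by [g] up to a scalar,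
   since [g2] divides D(g) by induction. The scalar [c1] need not be killed by [D], hence the extra
   multiple of [m]. *)
have := congr1 D E1; rewrite -mul_polyC !DM => E.
rewrite -(dvdpZr _ _ c10) -mul_polyC.
have -> : c1%:P * D m = D r * g + r * D g - D c1%:P * m by rewrite -E addrC addKr.
apply: dvdp_sub; last by apply: dvdp_mull; rewrite dvdp_gcdl.
apply: dvdp_add; first by apply: dvdp_mull.
by rewrite -(dvdpZl _ _ c30) E3 dvdp_mul.
Qed.

End PseudoDivision.

(** * The Jacobi identity carried over to the inverse matrix *)

Section Closedness.
Variables (A : idomainType) (n : nat) (c : 'I_n -> 'I_n -> 'I_n -> A) (Y : 'I_n -> A).
Hypothesis c_jacobi : forall p q r s,
  \sum_l (c p q l * c l r s + c q r l * c l p s + c r p l * c l q s) = 0.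
Variables (M W : 'M[A]_n) (m : A).
Hypothesis ME : forall p q, M p q = \sum_k c p q k * Y k.
Hypothesis W_skew : W^T = - W.
Hypothesis m0 : m != 0.
Hypothesis MW : M *m W = m%:M.

(** When [c p q i] is the [i]-th derivative of [M p q], [B j k i] is the part of m times the
    derivative of [W j k] that is free of derivatives of [m]. [J p q r] is the value of [Y] on
    [[e_p, e_q], e_r]. *)
Let B j k i := \sum_p \sum_q W j p * W k q * c p q i.
Let J p q r := \sum_l c p q l * M l r.

Let J_cyc p q r : J p q r + J q r p + J r p q = 0.
Proof.
have JE p' q' r' : J p' q' r' = \sum_s \sum_l c p' q' l * c l r' s * Y s.
  rewrite exchange_big; apply: eq_bigr => l _.
  by rewrite ME mulr_sumr; apply: eq_bigr => s _; rewrite mulrA.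
rewrite !JE -!big_split big1 //= => s _; rewrite -!big_split /=.
transitivity ((\sum_l (c p q l * c l r s + c q r l * c l p s + c r p l * c l q s)) * Y s).
  by rewrite mulr_suml; apply: eq_bigr => l _; rewrite !mulrDl.
by rewrite c_jacobi mul0r.
Qed.

Let mB j k i :
  m * B j k i = - \sum_p \sum_q \sum_r W j p * W k q * W i r * J p q r.
Proof.
have E q i' : \sum_r M q r * W r i' = (q == i')%:R * m.
  by have /matrixP/(_ q i') := MW; rewrite !mxE mulr_natl.
have W_skewE r i' : W r i' = - W i' r.
  by have /matrixP/(_ i' r) := W_skew; rewrite !mxE => ->.
rewrite /B mulr_sumr -sumrN; apply: eq_bigr => p _.
rewrite mulr_sumr -sumrN; apply: eq_bigr => q _.
transitivity (W j p * W k q * \sum_l c p q l * ((l == i)%:R * m)).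
  rewrite (bigD1 i) //= eqxx mul1r big1 ?addr0; first by ring.
  by move=> l /negPf ->; rewrite mul0r mulr0.
rewrite (eq_bigr (fun l => \sum_r c p q l * M l r * W r i)); last first.
  by move=> l _; rewrite -E mulr_sumr; apply: eq_bigr => r _; rewrite mulrA.
rewrite exchange_big mulr_sumr -sumrN; apply: eq_bigr => r _.
rewrite /J -mulr_suml (W_skewE r i); ring.
Qed.

(** Inserting [M *m W = m%:M] at the last index makes [m * B] a contraction of [J] with three rows
    of [W], and the cyclic sum of [J] is zero. *)
Lemma jacobi_inverse i j k : B j k i + B k i j + B i j k = 0.
Proof.
have rot (F : 'I_n -> 'I_n -> 'I_n -> A) :
    \sum_p \sum_q \sum_r F p q r = \sum_p \sum_q \sum_r F q r p.
  transitivity (\sum_p \sum_r \sum_q F p q r); last by rewrite exchange_big.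
  by apply: eq_bigr => p _; rewrite exchange_big.
apply: (mulfI m0); rewrite mulr0 !mulrDr !mB [\sum_p _ in X in _ + X + _]rot.
rewrite [\sum_p _ in X in _ + X]rot [\sum_p _ in X in _ + X]rot.
rewrite -!opprD -!big_split /= big1 ?oppr0 // => p _.
rewrite -!big_split /= big1 // => q _; rewrite -!big_split /= big1 // => r _.
transitivity (W j p * W k q * W i r * (J p q r + J q r p + J r p q)); first by ring.
by rewrite J_cyc mulr0.
Qed.

End Closedness.

(** * Decomposability of a closed form along its poles *)

Section PoleRank.
Import Pdiv.Idomain.
Variables (R : idomainType) (n : nat).
Hypothesis char0 : forall k, k.+1%:R != 0 :> R.

Lemma derivation0 (A : nzRingType) (D : A -> A) : derivation D -> D 0 = 0.
Proof. by case=> DD _; apply: (addrI (D 0)); rewrite -DD !addr0. Qed.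

Lemma derivation_sum (A : nzRingType) (D : A -> A) (I : finType) (F : I -> A) :
  derivation D -> D (\sum_i F i) = \sum_i D (F i).
Proof.
by move=> dD; case: (dD) => DD _; apply: (big_morph _ DD); apply: derivation0.
Qed.

Lemma derivation_mulmx (A : nzRingType) (D : A -> A) (W M : 'M[A]_n) m :
    derivation D -> W *m M = m%:M ->
  map_mx D W *m M + W *m map_mx D M = (D m)%:M.
Proof.
move=> dD WM; have [DD DM] := dD; apply/matrixP => i j.
have /matrixP/(_ i j)/(congr1 D) := WM; rewrite !mxE derivation_sum // => E.
rewrite -big_split /=.
have -> : D m *+ (i == j) = D (m *+ (i == j)) by case: eqP => _ //=; rewrite derivation0.
by rewrite -E; apply: eq_bigr => l _; rewrite !mxE DM.
Qed.

Variables (D : 'I_n -> {poly R} -> {poly R}) (a : 'I_n -> R).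
Hypothesis D_der : forall i, derivation (D i).
Variables (c : 'I_n -> 'I_n -> 'I_n -> {poly R}) (Y : 'I_n -> {poly R}).
Hypothesis c_jacobi : forall p q r s,
  \sum_l (c p q l * c l r s + c q r l * c l p s + c r p l * c l q s) = 0.
Variables (M W : 'M[{poly R}]_n) (m : {poly R}).
Hypothesis ME : forall p q, M p q = \sum_k c p q k * Y k.
Hypothesis DM : forall i p q, D i (M p q) = c p q i.
Hypothesis M_deriv : forall p q, (M p q)^`() = - \sum_k (a k)%:P * c p q k.
Hypothesis W_skew : W^T = - W.
Hypothesis m0 : m != 0.
Hypotheses (MW : M *m W = m%:M) (WM : W *m M = m%:M).
Hypothesis bezout : exists2 e, e != 0 &
  exists u : option ('I_n * 'I_n) -> {poly R},
    \sum_o u o * (if o is Some ij then W ij.1 ij.2 else m) = e%:P.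

(** This is d(W / m) = 0 multiplied by the square of [m]: differentiating [W *m M = m%:M] leaves,
    besides dm, the terms summed in [jacobi_inverse]. *)
Lemma closed_form i j k :
  m * (D i (W j k) + D j (W k i) + D k (W i j)) =
    D i m * W j k + D j m * W k i + D k m * W i j.
Proof.
have dW i' j' k' : m * D i' (W j' k') = D i' m * W j' k' +
    \sum_p \sum_q W j' p * W k' q * c p q i'.
  have := congr1 (fun X => (X *m W) j' k') (derivation_mulmx (D_der i') WM).
  rewrite /= mulmxDl -mulmxA MW mul_mx_scalar mul_scalar_mx !mxE => <-.
  rewrite -addrA -[LHS]addr0; congr (_ + _); rewrite exchange_big -big_split.
  rewrite big1 // => q _; rewrite !mxE /= mulr_suml -big_split big1 // => p _.
  rewrite !mxE DM /=; have /matrixP/(_ k' q) := W_skew; rewrite !mxE => ->.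
  by rewrite mulrN mulrAC addNr.
rewrite !mulrDr !dW.
have := jacobi_inverse c_jacobi ME W_skew m0 MW i j k.
set b1 := (\sum_p _); set b2 := (\sum_p _); set b3 := (\sum_p _) => E.
transitivity (D i m * W j k + D j m * W k i + D k m * W i j + (b1 + b2 + b3)).
  by ring.
by rewrite E addr0.
Qed.

(** The derivative along the direction (a, 1). It annihilates [M], which depends on x - l a only, l
    being ['X]. *)
Let nabla p := \sum_k (a k)%:P * D k p + p^`().

Let nabla_derivation : derivation nabla.
Proof.
split=> p q; rewrite /nabla.
  rewrite derivD addrACA -big_split; congr (_ + _); apply: eq_bigr => k _.
  by have [-> _] := D_der k; rewrite mulrDr.
rewrite derivM mulrDl mulrDr addrACA; congr (_ + _).
rewrite mulr_suml mulr_sumr -big_split; apply: eq_bigr => k _.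
have [_ ->] := D_der k; rewrite /=; ring.
Qed.

(** Since [nabla] annihilates [M], it satisfies m * nabla W = nabla m * W. Thus [m] divides
    [nabla m] times each entry of [W], and [bezout], which says that W / m is in lowest terms,
    removes these entries. *)
Lemma dvdp_nabla : exists2 e, e != 0 & exists w, e *: nabla m = w * m.
Proof.
have [e e0 [u E]] := bezout; exists e => //.
have nM : map_mx nabla M = 0.
  apply/matrixP => p q; rewrite !mxE /nabla M_deriv.
  by under eq_bigr do rewrite DM; rewrite addrN.
have := derivation_mulmx nabla_derivation WM.
rewrite nM mulmx0 addr0 => /(congr1 (fun X => X *m W)).
rewrite -mulmxA MW mul_mx_scalar mul_scalar_mx => nW.
exists (\sum_o u o * nabla (if o is Some ij then W ij.1 ij.2 else m)).
rewrite -mul_polyC -E !mulr_suml; apply: eq_bigr => -[[i j]|] _; last by ring.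
have /matrixP/(_ i j) := nW; rewrite !mxE => nWE /=.
by rewrite -mulrA [W i j * _]mulrC -nWE -mulrA [_ * m]mulrC.
Qed.

(* [d(W / m) = 0] gives [r | kappa /\ W] with [kappa = dm / gcd(m, m')], and the
   contraction of [kappa] with [a] is invertible modulo [r]: modulo [r] the form
   [W] is a multiple of a decomposable one. *)
Theorem pole_decomposable : exists2 e, e != 0 & exists r s g,
  [/\ e *: m = r * g, e *: m^`() = s * g &
      forall i j k l, r %| W i j * W k l - W i k * W j l + W i l * W j k].
Proof.
pose g := gcdp m m^`(); have g0 : g != 0 by rewrite gcdp_eq0 negb_and m0.
have [e e0 [q qE]] := @common_cofactor R (option (option 'I_n))
  (fun o => if o is Some o' then if o' is Some i then D i m else m^`() else m) g
  (fun o => match o with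
            | None => dvdp_gcdl m m^`()
            | Some None => dvdp_gcdr m m^`()
            | Some (Some i) => gcdp_deriv_dvd char0 (D_der i) m end).
have Em := qE None; have Em' := qE (Some None); have EDm i := qE (Some (Some i)).
move: (q None) (q (Some None)) Em Em' => r s /= Em Em'.
pose kap i := q (Some (Some i)); rewrite /= in EDm.
exists e => //; exists r, s, g; split=> //.
have co_rs : coprimep r s.
  rewrite -gcdp_eqp1 -(eqp_mul2r _ _ g0) mul1r (eqp_ltrans (mulp_gcdl _ _ _)).
  by rewrite -Em -Em'; apply: eqp_gcd; apply: eqp_scale.
pose ka := \sum_i (a i)%:P * kap i.
(* The derivative along l contributes m' to [nabla m]; dividing [dvdp_nabla] by [g] makes [ka]
   congruent to -s modulo [r], up to the scalar [e1]. *)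
have co_rk : coprimep r ka.
  have [e1 e10 [w Ew]] := dvdp_nabla.
  rewrite -(coprimepZr _ _ e10).
  have -> : e1 *: ka = w * r - e1 *: s.
    have Eka : ka * g = e *: \sum_i (a i)%:P * D i m.
      rewrite scaler_sumr mulr_suml; apply: eq_bigr => i _.
      by rewrite -mulrA -EDm scalerAr.
    apply: (mulIf g0); transitivity (e1 *: (ka * g)); first by rewrite scalerAl.
    transitivity (w * (r * g) - e1 *: (s * g)); last by rewrite mulrBl mulrA scalerAl.
    rewrite Eka -Em -Em' -scalerAr -Ew /nabla -!mul_polyC; ring.
  by rewrite coprimep_addl_mul -scaleNr coprimepZr ?oppr_eq0.
(* [closed_form] scaled by [e] and divided by [g]: its left side becomes a multiple of [r]. *)
have kW i j k : r %| kap i * W j k + kap j * W k i + kap k * W i j.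
  apply/dvdpP; exists (1, D i (W j k) + D j (W k i) + D k (W i j)).
    exact: oner_neq0.
  rewrite scale1r /=; apply: (mulIf g0).
  transitivity (e *: (D i m * W j k + D j m * W k i + D k m * W i j)).
    rewrite !scalerDr !scalerAl !EDm -/(kap i) -/(kap j) -/(kap k); ring.
  rewrite -closed_form scalerAl Em; ring.
pose be k := \sum_i (a i)%:P * W i k.
(* Contraction of the previous relation with [a]: modulo [r], [ka] times [W] is the decomposable
   form kap /\ be. *)
have kaW j k : r %| ka * W j k - kap j * be k + kap k * be j.
  suff -> : ka * W j k - kap j * be k + kap k * be j =
      \sum_i (a i)%:P * (kap i * W j k + kap j * W k i + kap k * W i j).
    by apply: (big_ind (fun p => r %| p)); [exact: dvdp0 | exact: dvdp_add |
       move=> i _; apply: dvdp_mull].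
  rewrite /ka /be mulr_suml !mulr_sumr -sumrN -!big_split; apply: eq_bigr => i _ /=.
  have /matrixP/(_ k i) := W_skew; rewrite !mxE => ->; ring.
move=> i j k l.
have co_rk2 : coprimep r (ka * ka) by rewrite coprimepMr co_rk.
rewrite -(Gauss_dvdpr _ co_rk2).
pose x j k := ka * W j k - kap j * be k + kap k * be j.
pose y j k := kap j * be k - kap k * be j.
(* Write ka * W = x + y, with [x] divisible by [r] and [y] decomposable; the terms in [y] alone
   cancel by the Plücker relation. *)
have -> : ka * ka * (W i j * W k l - W i k * W j l + W i l * W j k) =
  (x i j * (ka * W k l) + y i j * x k l) - (x i k * (ka * W j l) + y i k * x j l)
  + (x i l * (ka * W j k) + y i l * x j k).
  by rewrite /x /y; ring.
apply: dvdp_add; first apply: dvdp_sub; apply: dvdp_add;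
  by [apply: dvdp_mulr; apply: kaW | apply: dvdp_mull; apply: kaW].
Qed.

End PoleRank.

(** * The pencil at a generic point *)

Lemma C_char0 k : (k.+1%:R : C) != 0.
Proof.
apply/negP => /eqP E.
have := @Num.Theory.pnatr_eq0 (complex.complex Rdefinitions.R : numDomainType) k.+1.
by move=> /= /negP; apply; apply/eqP; exact: E.
Qed.

Lemma mpoly_char0 n k : (k.+1%:R : {mpoly C[n]}) != 0.
Proof. by rewrite -(rmorph_nat (@mpolyC n C)) mpolyC_eq0 C_char0. Qed.

Section StructureConstants.
Variables (n : nat) (g : lie_algebra n).

Definition structure_const (p q k : 'I_n) : C :=
  lie_br g (basis_vec p) (basis_vec q) 0 k.

Lemma form_AE (x : 'rV_n) p q :
  form_A g x p q = \sum_k structure_const p q k * x 0 k.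
Proof. by rewrite mxE; apply: eq_bigr => k _; rewrite mulrC. Qed.

Lemma lie_brDl x y z : lie_br g (x + y) z = lie_br g x z + lie_br g y z.
Proof. by have := lie_br_linl g 1 x y z; rewrite !scale1r. Qed.

Lemma lie_brDr x y z : lie_br g z (x + y) = lie_br g z x + lie_br g z y.
Proof. by have := lie_br_linr g 1 x y z; rewrite !scale1r. Qed.

Lemma lie_br0l z : lie_br g 0 z = 0.
Proof. by apply: (addrI (lie_br g 0 z)); rewrite -lie_brDl !addr0. Qed.

Lemma lie_brC x y : lie_br g x y = - lie_br g y x.
Proof.
apply/eqP; rewrite -addr_eq0; apply/eqP; have := lie_br_alt g (x + y).
by rewrite lie_brDl !lie_brDr !lie_br_alt addr0 add0r.
Qed.

Lemma lie_br_suml u z : lie_br g u z = \sum_l u 0 l *: lie_br g (basis_vec l) z.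
Proof.
rewrite {1}[u]row_sum_delta.
apply: (big_ind2 (fun v w => lie_br g v z = w)); first exact: lie_br0l.
  by move=> v1 w1 v2 w2 <- <-; apply: lie_brDl.
move=> l _; have := lie_br_linl g (u 0 l) (basis_vec l) 0 z.
by rewrite addr0 lie_br0l addr0.
Qed.

Lemma structure_const_jacobi p q r s :
  \sum_l (structure_const p q l * structure_const l r s +
    structure_const q r l * structure_const l p s +
    structure_const r p l * structure_const l q s) = 0.
Proof.
have E x y z : \sum_l structure_const x y l * structure_const l z s =
    - lie_br g (basis_vec z) (lie_br g (basis_vec x) (basis_vec y)) 0 s.
  rewrite [lie_br g (basis_vec z) _]lie_brC lie_br_suml !mxE opprK summxE.
  by apply: eq_bigr => l _; rewrite mxE.
rewrite !big_split /= !E -!opprD.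
have /matrixP/(_ 0 s) := lie_br_jacobi g (basis_vec r) (basis_vec p) (basis_vec q).
by rewrite !mxE => ->; rewrite oppr0.
Qed.

Lemma form_A_skew x : (form_A g x)^T = - form_A g x.
Proof.
apply/matrixP => p q; rewrite !mxE /pairing -sumrN; apply: eq_bigr => k _.
by rewrite lie_brC !mxE mulrN.
Qed.

Lemma form_A_linear b x y : form_A g (b *: x + y) = b *: form_A g x + form_A g y.
Proof.
apply/matrixP => p q; rewrite !mxE /pairing mulr_sumr -big_split.
by apply: eq_bigr => k _; rewrite !mxE /= mulrDl mulrA.
Qed.

End StructureConstants.

Lemma map_poly_derivation (A : nzRingType) (d : A -> A) :
  derivation d -> derivation (map_poly d).
Proof.
move=> dd; have d0 := derivation0 dd; case: (dd) => dD dM; split=> p q.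
  by apply/polyP => i; rewrite coefD !coef_map_id0 // coefD dD.
apply/polyP => i; rewrite coefD coef_map_id0 // !coefM derivation_sum // -big_split.
by apply: eq_bigr => j _; rewrite dM !coef_map_id0.
Qed.

(** With a nonzero pivot [S i j], the Plücker relations express every entry through rows [i] and
    [j]. *)
Lemma skew_decomposable (F : fieldType) n (S : 'M[F]_n) :
    (forall i j k l, S i j * S k l - S i k * S j l + S i l * S j k = 0) ->
  exists u w : 'rV_n, S = u^T *m w - w^T *m u.
Proof.
move=> S4; have [->|S0] := eqVneq S 0; first by exists 0, 0; rewrite !mulmx0 subr0.
have [i [j Sij]] : exists i j, S i j != 0.
  have /matrix0Pn[i [j Sij]] := S0; by exists i, j.
exists ((S i j)^-1 *: row i S), (row j S); apply/matrixP => k l.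
rewrite !mxE !big_ord1 !mxE; apply: (mulfI Sij).
transitivity (S i k * S j l - S i l * S j k).
  by apply/eqP; rewrite -subr_eq0 -(S4 i j k l); apply/eqP; ring.
by field.
Qed.

(** A root of order k+1 of [m] has order only k in m', so [g] cannot absorb it. Only divisibilities
    are assumed because [g] need not remain a gcd of [m] and m' once numbers are substituted for
    [x]. *)
Lemma root_cofactor (F : fieldType) (m r g : {poly F}) l :
    (forall k, k.+1%:R != 0 :> F) ->
  m != 0 -> root m l -> m %| r * g -> g %| m^`() -> root r l.
Proof.
move=> char0 m0 ml mrg gm'; apply: contraT => rl.
have [k [p]] := multiplicity_XsubC m l; rewrite m0 /= => pl Em.
case: k Em => [|k] Em; first by rewrite Em expr0 mulr1 (negPf pl) in ml.
have : ('X - l%:P) ^+ k.+1 %| m^`().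
  apply: dvdp_trans gm'; rewrite -(Gauss_dvdpr _ (_ : coprimep _ r)).
    by apply: dvdp_trans mrg; rewrite Em dvdp_mull.
  by apply: coprimep_expl; rewrite coprimep_sym coprimep_XsubC.
rewrite Em derivM deriv_exp derivXsubC mul1r (dvdp_addr _ (dvdp_mull _ (dvdpp _))).
rewrite -mulr_natr mulrA mulrAC exprS dvdp_mul2r ?expf_neq0 ?polyXsubC_eq0 //.
rewrite dvdp_XsubCl rootM (negPf pl) /= -polyC_natr rootC => k0.
by have := char0 k; rewrite k0.
Qed.

Definition pencil n (A B : 'M[C]_n) : 'M[{poly C}]_n :=
  map_mx polyC A - 'X *: map_mx polyC B.

Lemma pencilE n (A B : 'M[C]_n) p q : pencil A B p q = (A p q)%:P - 'X * (B p q)%:P.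
Proof. by rewrite !mxE. Qed.

(** * The inverse of the pencil in lowest terms, for generic x and fixed a *)

Section GenericPencil.
Import Pdiv.Idomain.
Variables (n : nat) (g : lie_algebra n) (a : 'rV[C]_n).
Hypothesis a_regular : \det (form_A g a) != 0.

Let R := {mpoly C[n]}.
Let c p q k : {poly R} := ((structure_const g p q k)%:MP)%:P.
(** The coordinates of x - l a: ['X_k] in [R] is a coordinate of the generic [x], the outer ['X] is
    l. *)
Let Y k : {poly R} := ('X_k)%:P - (a 0 k)%:MP%:P * 'X.
Let M : 'M[{poly R}]_n := \matrix_(p, q) \sum_k c p q k * Y k.
Local Notation ev x := (map_poly (meval (fun_of_matrix x 0))).

Let ev_M x : map_mx (ev x) M = pencil (form_A g x) (form_A g a).
Proof.
apply/matrixP => p q; rewrite pencilE !form_AE [LHS]mxE [M p q]mxE.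
rewrite rmorph_sum !rmorph_sum /= mulr_sumr -sumrB; apply: eq_bigr => k _.
rewrite rmorphM rmorphB rmorphM /= !map_polyC map_polyX /= !mevalC mevalXU.
by rewrite !polyCM; ring.
Qed.

Let detM : \det M != 0.
Proof.
apply: contraNneq a_regular => M0.
(* At x = 0 and l = -1 the vector x - l a is [a], whose form is invertible. *)
have := ev_M 0 => /(congr1 (fun X => \det X)); rewrite det_map_mx M0 rmorph0.
move=> /(congr1 (horner_eval (- 1))); rewrite rmorph0 -det_map_mx => E.
rewrite [X in _ == X]E; apply/eqP; congr (\det _); apply/matrixP => p q.
have -> : form_A g 0 = 0.
  by apply/matrixP => i j; rewrite form_AE mxE big1 // => k _; rewrite mxE mulr0.
rewrite [RHS]mxE pencilE [(0 : 'M_n) p q]mxE; move: (form_A g a p q) => b.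
by rewrite /= /horner_eval !hornerE; ring.
Qed.

Let M_skew : M^T = - M.
Proof.
apply/matrixP => p q; rewrite !mxE -sumrN; apply: eq_bigr => k _.
by rewrite /c /structure_const lie_brC mxE !rmorphN mulNr.
Qed.

Let c_jacobi p q r s :
  \sum_l (c p q l * c l r s + c q r l * c l p s + c r p l * c l q s) = 0.
Proof.
pose f := polyC \o @mpolyC n C.
rewrite (eq_bigr (fun l => f (structure_const g p q l * structure_const g l r s +
    structure_const g q r l * structure_const g l p s +
    structure_const g r p l * structure_const g l q s))) => [|l _].
  by rewrite -rmorph_sum structure_const_jacobi rmorph0.
by rewrite /f /= !(rmorphD, rmorphM).
Qed.

Let D (i : 'I_n) : {poly R} -> {poly R} := map_poly (mderiv i).

Let D_der i : derivation (D i).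
Proof. by apply: map_poly_derivation; split=> p q; [exact: mderivD | exact: mderivM]. Qed.

Let DC i (f : R) : D i f%:P = (mderiv i f)%:P.
Proof. exact: map_polyC. Qed.

Let DX i : D i 'X = 0.
Proof.
apply/polyP => k; rewrite coef_map_id0 ?mderiv0 // coefX coef0 -mpolyC_nat.
exact: mderivC.
Qed.

Let DM i p q : D i (M p q) = c p q i.
Proof.
have [Dadd Dmul] := D_der i.
have DY k : D i (Y k) = (k == i)%:R.
  rewrite /Y Dadd -mulNr -polyCN Dmul !DC DX -mpolyCN mderivC mul0r mulr0 !addr0.
  rewrite mderivX mnm1E; case: eqP => [->|_]; last by rewrite scale0r.
  have -> : (U_(i) - U_(i) = 0)%MM by apply/mnmP => j; rewrite mnmBE subnn mnm0E.
  by rewrite scale1r mpolyX0.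
rewrite mxE derivation_sum // (bigD1 i) //= big1 ?addr0 => [|k /negPf ki].
  by rewrite Dmul DC mderivC DY eqxx mul0r add0r mulr1.
by rewrite Dmul DC mderivC DY ki mul0r add0r mulr0.
Qed.

Let M_deriv p q : (M p q)^`() = - \sum_k (a 0 k)%:MP%:P * c p q k.
Proof.
rewrite mxE raddf_sum -sumrN; apply: eq_bigr => k _.
rewrite /= /c /Y derivM derivB derivM !derivC derivX; ring.
Qed.

(** [W / m] is in lowest terms, so [W] is nonzero at each root of [m]; such a root is also a root of
    the squarefree part, where the Plücker relations hold. *)
Lemma generic_pole :
  exists2 Delta : {mpoly C[n]}, Delta != 0 &
  forall x : 'rV_n, meval (x 0) Delta != 0 ->
  exists (W : 'M[{poly C}]_n) (m : {poly C}),
  [/\ m != 0, W *m pencil (form_A g x) (form_A g a) = m%:M &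
      forall l, root m l -> map_mx (horner_eval l) W != 0 /\
        exists u w : 'rV_n, map_mx (horner_eval l) W = u^T *m w - w^T *m u].
Proof.
(* The entries of the adjugate and, at [None], the determinant. Dividing them all by their gcd [G]
   reduces the inverse to lowest terms. *)
pose p (o : option ('I_n * 'I_n)) :=
  if o is Some ij then (\adj M) ij.1 ij.2 else \det M.
have [u /common_cofactor[e e0 [q qE]]] := bezout_family p.
set G := \sum_j _ in qE.
pose m := q None; pose W := \matrix_(i, j) q (Some (i, j)).
have Em : e *: \det M = m * G := qE None.
have EW : e%:P *: \adj M = G *: W.
  apply/matrixP => i j; rewrite [LHS]mxE [RHS]mxE [W i j]mxE mul_polyC [RHS]mulrC.
  exact: (qE (Some (i, j))).
have /andP[m0 G0] : (m != 0) && (G != 0).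
  by rewrite -negb_or -mulf_eq0 -Em -mul_polyC mulf_eq0 polyC_eq0 negb_or e0 detM.
have GI (X X' : 'M[{poly R}]_n) : G *: X = G *: X' -> X = X'.
  move=> E; apply/matrixP => i j; apply: (mulfI G0).
  by have /matrixP/(_ i j) := E; rewrite !mxE.
have WM : W *m M = m%:M.
  apply: GI; rewrite scalemxAl -EW -scalemxAl mul_adj_mx !scale_scalar_mx [G * m]mulrC -Em.
  by rewrite mul_polyC.
have MW : M *m W = m%:M.
  apply: GI; rewrite scalemxAr -EW -scalemxAr mul_mx_adj !scale_scalar_mx [G * m]mulrC -Em.
  by rewrite mul_polyC.
have W_skew : W^T = - W.
  have := congr1 (fun X => (X^T) *m W) MW.
  rewrite /= trmx_mul M_skew mulmxN mulNmx -mulmxA MW mul_mx_scalar tr_scalar_mx.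
  rewrite mul_scalar_mx => E; apply/matrixP => i j; apply: (mulfI m0).
  by have /matrixP/(_ i j) := E; rewrite !mxE mulrN => /esym ->; rewrite opprK.
have bez : exists2 e, e != 0 & exists u : option ('I_n * 'I_n) -> {poly R},
    \sum_o u o * (if o is Some ij then W ij.1 ij.2 else m) = e%:P.
  exists e => //; exists u; apply: (mulIf G0); rewrite mul_polyC {2}/G scaler_sumr.
  rewrite mulr_suml; apply: eq_bigr => o _; rewrite -mulrA scalerAr qE.
  by case: o => [[i j]|] //=; rewrite mxE.
have [e1 e10 [r [s [h [Er Es rW]]]]] := pole_decomposable (@mpoly_char0 n) D_der c_jacobi
  (fun p q => mxE _ _ p q) DM M_deriv W_skew m0 MW WM bez.
have [e2 e20 [t tE]] := common_cofactor (fun z : ('I_n * 'I_n) * ('I_n * 'I_n) =>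
  rW z.1.1 z.1.2 z.2.1 z.2.2).
have [e3 e30 [v vE]] := bez.
(* The scalars come from the squarefree factorization, the Plücker relations and the Bezout
   identity; the leading coefficient keeps the specialized [m] nonzero. *)
exists (e1 * e2 * e3 * lead_coef m); first by rewrite !mulf_neq0 ?lead_coef_eq0.
move=> x; rewrite !rmorphM !mulf_eq0 !negb_or -!andbA => /and4P[x1 x2 x3 xm].
have evC f : ev x f%:P = (meval (x 0) f)%:P by apply: map_polyC.
have evZ f p' : ev x (f *: p') = (meval (x 0) f) *: ev x p'.
  by rewrite -!mul_polyC rmorphM /= evC.
have em0 : ev x m != 0.
  by apply: contraNneq xm => /(congr1 (fun p : {poly C} => p`_(size m).-1)); rewrite coef_map coef0 => ->.
exists (map_mx (ev x) W), (ev x m); split=> // [|l lm].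
  by rewrite -ev_M -map_mxM WM map_scalar_mx.
have lr : root (ev x r) l.
  apply: (@root_cofactor _ (ev x m) _ (ev x h)) => //; first exact: C_char0.
    by rewrite -rmorphM /= -Er evZ dvdpZr.
  by rewrite deriv_map -(dvdpZr _ _ x1) -evZ Es rmorphM dvdp_mull.
split.
  apply: contraNneq x3 => /matrixP W0.
  have := congr1 (fun p => (ev x p).[l]) vE; rewrite /= evC hornerC => <-.
  rewrite rmorph_sum horner_sum big1 // => o _; rewrite rmorphM hornerM.
  case: o => [[i j]|] /=; last by rewrite (rootP lm) mulr0.
  by have := W0 i j; rewrite !mxE /horner_eval => ->; rewrite mulr0.
apply: skew_decomposable => i j k k'.
have := congr1 (fun p => (ev x p).[l]) (tE ((i, j), (k, k'))).
rewrite /= evZ hornerZ [ev x (t _ * r)]rmorphM hornerM (rootP lr) mulr0.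
move=> /eqP; rewrite mulf_eq0 (negPf x2) /= => /eqP.
by rewrite !(rmorphB, rmorphD, rmorphM) !hornerE !mxE.
Qed.

End GenericPencil.

(** * Jordan blocks of a pencil *)

Definition shape_of (s : seq jkblock) : seq nat := [seq jk_size b | b <- s].

Lemma flatten_index_cons m sh b i :
  flatten_index (m :: sh) b.+1 i = (m + flatten_index sh b i)%N.
Proof. by rewrite /flatten_index /= addnA. Qed.

Lemma blockdiag_flatten f s b b' i j :
    (i < nth 0 (shape_of s) b)%N -> (j < nth 0 (shape_of s) b')%N ->
  blockdiag f s (flatten_index (shape_of s) b i) (flatten_index (shape_of s) b' j) =
    if b == b' then f (nth (JKKron 0) s b) i j else 0.
Proof.
elim: s b b' => [|x s IH] [|b] [|b'] //=.
- by rewrite /flatten_index /= !add0n => -> ->.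
- rewrite flatten_index_cons {1}/flatten_index /= add0n => im jm.
  by rewrite [(_ + _ < _)%N]ltnNge leq_addr andbF leqNgt im.
- rewrite flatten_index_cons {2}/flatten_index /= add0n => im jm.
  by rewrite [(_ + _ < _)%N]ltnNge leq_addr /= [(_ <= j)%N]leqNgt jm.
rewrite !flatten_index_cons => im jm.
by rewrite [(_ + _ < _)%N]ltnNge !leq_addr /= !addKn IH.
Qed.

Lemma big_flatten_index (A : nmodType) sh (F : nat -> A) :
  \sum_(k < sumn sh) F k =
  \sum_(b < size sh) \sum_(i < nth 0 sh b) F (flatten_index sh b i).
Proof.
elim: sh F => [|m sh IH] F /=; first by rewrite !big_ord0.
rewrite big_split_ord big_ord_recl /=; congr (_ + _).
rewrite (IH (fun k => F (m + k)%N)); apply: eq_bigr => b _; apply: eq_bigr => i _.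
by rewrite flatten_index_cons.
Qed.

Lemma sum_delta (A : pzRingType) N (V : nat -> A) k x :
  \sum_(i < N) V i * ((nat_of_ord i == k)%:R * x) = if (k < N)%N then V k * x else 0.
Proof.
case: ifP => kN.
  rewrite (bigD1 (Ordinal kN)) //= eqxx mul1r big1 ?addr0 // => i ik.
  by rewrite -(inj_eq val_inj) /= in ik; rewrite (negPf ik) mul0r mulr0.
rewrite big1 // => i _; case: eqP => [ik|]; last by rewrite mul0r mulr0.
by rewrite -ik ltn_ord in kN.
Qed.

Definition pencil_entry (b : jkblock) i j : {poly C} :=
  (blockA b i j)%:P - 'X * (blockB b i j)%:P.

(** [eig_factor] and [next_factor] are the diagonal and superdiagonal entries of the upper right
    block of the pencil: J_l - 'X for a finite eigenvalue l, 1 - 'X J_0 for infinity. *)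
Definition eig_factor (mu : option C) : {poly C} :=
  if mu is Some l then l%:P - 'X else 1.
Definition next_factor (mu : option C) : {poly C} :=
  if mu is Some l then 1 else - 'X.

Lemma eig_factor_neq0 mu : eig_factor mu != 0.
Proof.
case: mu => [l|] /=; last exact: oner_neq0.
by rewrite -opprB oppr_eq0 polyXsubC_eq0.
Qed.

Lemma pencil_entry_right mu m i j : (i < 2 * m)%N -> (j < m)%N ->
  pencil_entry (JKJordan mu m) i (m + j) =
    (i == j)%:R * eig_factor mu + (i.+1 == j)%:R * next_factor mu.
Proof.
move=> im jm; have [lt_im|le_mi] := ltnP i m.
  rewrite /pencil_entry /eig_factor /next_factor /blockA /blockB.
  case: mu => [l|]; rewrite /skew_of lt_im leq_addr addKn /= /jordan_entry /id_entry.
    rewrite [j == _]eq_sym; case: (eqVneq i j) => [->|_].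
      by rewrite -[j.+1]addn1 -[X in _ == X]addn0 eqn_add2l /= polyC1; ring.
    by case: eqP => _; rewrite ?polyC0 ?polyC1 /=; ring.
  rewrite [j == _]eq_sym; case: (eqVneq i j) => [->|_].
    by rewrite -[j.+1]addn1 -[X in _ == X]addn0 eqn_add2l /= polyC1 polyC0; ring.
  by case: eqP => _; rewrite ?polyC0 ?polyC1 /=; ring.
have -> : (i == j) = false by apply/negbTE; lia.
have -> : (i.+1 == j) = false by apply/negbTE; lia.
rewrite !mul0r addr0 /pencil_entry.
by case: mu => [l|] /=; rewrite /skew_of [(i < m)%N]ltnNge le_mi /=
  [(m + j < m)%N]ltnNge leq_addr /= polyC0; ring.
Qed.

Lemma pencil_entry_left mu m i j : (i < 2 * m)%N -> (j < m)%N ->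
  pencil_entry (JKJordan mu m) i j =
    - ((i == m + j)%:R * eig_factor mu + (i == m + j.+1)%:R * next_factor mu).
Proof.
move=> im jm; have [lt_im|le_mi] := ltnP i m.
  have -> : (i == m + j)%N = false by apply/negbTE; lia.
  have -> : (i == m + j.+1)%N = false by apply/negbTE; lia.
  rewrite !mul0r addr0 oppr0 /pencil_entry.
  by case: mu => [l|] /=; rewrite /skew_of [(m <= j)%N]leqNgt jm andbF
    [(m <= i)%N]leqNgt lt_im /= polyC0; ring.
have E : pencil_entry (JKJordan mu m) j (m + (i - m)) =
    (j == i - m)%N%:R * eig_factor mu + (j.+1 == i - m)%N%:R * next_factor mu.
  by apply: pencil_entry_right; lia.
transitivity (- (pencil_entry (JKJordan mu m) j i)).
  rewrite /pencil_entry; case: mu {E} => [l|] /=;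
    by rewrite /skew_of [(i < m)%N]ltnNge le_mi jm /= polyCN; ring.
rewrite subnKC // in E; rewrite E.
have -> : (j == i - m)%N = (i == m + j)%N by lia.
by have -> : (j.+1 == i - m)%N = (i == m + j.+1)%N by lia.
Qed.

(** * Bidiagonal systems *)

Section Recurrence.
Variables (m : nat) (d e : {poly C}) (v h : nat -> {poly C}).
Hypothesis vE : forall j, (j < m)%N ->
  d * v j + (if j is j'.+1 then e * v j' else 0) = h j.

Lemma recurrence_zero :
  d != 0 -> (forall j, (j < m)%N -> h j = 0) -> forall j, (j < m)%N -> v j = 0.
Proof.
move=> d0 h0; elim=> [|j IH] jm; apply: (mulfI d0).
  by have := vE jm; rewrite h0 // addr0 mulr0.
by have := vE jm; rewrite h0 // IH 1?ltnW // mulr0 addr0 mulr0.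
Qed.

Lemma recurrence_dvd_coprime q : coprimep q d ->
  (forall j, (j < m)%N -> q %| h j) -> forall j, (j < m)%N -> q %| v j.
Proof.
move=> qd qh; elim=> [|j IH] jm; rewrite -(Gauss_dvdpr _ qd).
  by have := vE jm; rewrite addr0 => ->; apply: qh.
have := vE jm => /(canRL (addrK _)) ->; apply: dvdp_sub; first exact: qh.
by apply: dvdp_mull; apply: IH; apply: ltnW.
Qed.

(** Each equation is divided by [d] once, so [v j] keeps all but j+1 of the [k] factors. *)
Lemma recurrence_dvd k : d != 0 -> (m <= k)%N ->
  (forall j, (j < m)%N -> d ^+ k %| h j) ->
  forall j, (j < m)%N -> d ^+ (k - j.+1) %| v j.
Proof.
move=> d0 mk dh; elim=> [|j IH] jm; rewrite -(dvdp_mul2l _ _ d0) -exprS.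
  rewrite subn1 prednK; last exact: leq_trans jm mk.
  by have := vE jm; rewrite addr0 => ->; apply: dh.
rewrite subnSK; last exact: leq_trans jm mk.
have := vE jm => /(canRL (addrK _)) ->; apply: dvdp_sub.
  by apply: dvdp_trans (dh _ jm); apply: dvdp_exp2l; apply: leq_subr.
by apply: dvdp_mull; apply: IH; apply: ltnW.
Qed.

Lemma recurrence_solve : e = 1 -> (forall j, (j.+1 < m)%N -> h j.+1 = 0) ->
  forall j, (j < m)%N -> h 0%N = d * (- d) ^+ j * v j.
Proof.
move=> e1 h0; elim=> [|j IH] jm; first by rewrite -(vE jm) addr0 expr0 mulr1.
rewrite IH 1?ltnW // exprSr -!mulrA; congr (_ * (_ * _)).
have := vE jm; rewrite h0 // e1 mul1r => /eqP; rewrite addr_eq0 => /eqP E.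
by rewrite mulNr E opprK.
Qed.

End Recurrence.

Definition is_jordan (b : jkblock) : bool := if b is JKJordan _ _ then true else false.

Section BlockPencil.
Variable s : seq jkblock.
Notation sh := (shape_of s).
Notation idx b i := (flatten_index sh b i).
Notation blk b := (nth (JKKron 0) s b).

(** No bound on [b] is required: the default block [JKKron 0] has size 0. *)
Lemma nth_shape b : nth 0 sh b = jk_size (blk b).
Proof.
have [bs|sb] := ltnP b (size s); first by rewrite (nth_map (JKKron 0)).
by rewrite !nth_default ?size_map.
Qed.

Variable V : nat -> {poly C}.
Let VM c := \sum_(k < sumn sh)
  V k * ((blockdiag blockA s k c)%:P - 'X * (blockdiag blockB s k c)%:P).

Lemma block_column b j : (j < nth 0 sh b)%N ->
  VM (idx b j) = \sum_(i < nth 0 sh b) V (idx b i) * pencil_entry (blk b) i j.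
Proof.
move=> jb; have bs : (b < size sh)%N.
  by rewrite ltnNge; apply: contraL jb => /(nth_default 0) ->.
rewrite /VM (big_flatten_index sh (fun k =>
  V k * ((blockdiag blockA s k _)%:P - 'X * (blockdiag blockB s k _)%:P))).
rewrite (bigD1 (Ordinal bs)) //= [X in _ + X]big1 ?addr0 => [|b' b'b].
  by apply: eq_bigr => i _; rewrite !blockdiag_flatten // eqxx.
have b'bF : (nat_of_ord b' == b) = false.
  by apply/negbTE; rewrite -(inj_eq val_inj) in b'b.
by apply: big1 => i _; rewrite !blockdiag_flatten // b'bF polyC0 mulr0 subr0 mulr0.
Qed.

Variables (b m : nat) (mu : option C).
Hypothesis bE : blk b = JKJordan mu m.
Let shb : nth 0 sh b = (2 * m)%N. Proof. by rewrite nth_shape bE. Qed.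

Lemma right_recurrence j : (j < m)%N ->
  eig_factor mu * V (idx b j) +
    (if j is j'.+1 then next_factor mu * V (idx b j') else 0) = VM (idx b (m + j)).
Proof.
move=> jm; rewrite block_column shb; last by lia.
rewrite bE; under eq_bigr => i _ do rewrite pencil_entry_right // mulrDr.
rewrite big_split /= (sum_delta _ (fun i => V (idx b i))) (_ : (j < 2 * m)%N); last by lia.
rewrite mulrC; congr (_ + _); case: j jm => [|j] jm.
  by rewrite big1 // => i _; rewrite mul0r mulr0.
rewrite (eq_bigr (fun i => V (idx b (nat_of_ord i)) *
  ((nat_of_ord i == j)%:R * next_factor mu))) => [|i _]; last by rewrite eqSS.
by rewrite (sum_delta _ (fun i => V (idx b i))) (_ : (j < 2 * m)%N) 1?mulrC //; lia.
Qed.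

(** The lower left block is minus a transpose, so its columns couple an index with the following
    one; read backwards they give the recurrence of the right half. *)
Lemma left_recurrence j : (j < m)%N ->
  eig_factor mu * V (idx b (m + (m - j.+1))) +
    (if j is j'.+1 then next_factor mu * V (idx b (m + (m - j'.+1))) else 0) =
  - VM (idx b (m - j.+1)).
Proof.
move=> jm; rewrite block_column shb; last by lia.
rewrite bE -sumrN; have mj : (m - j.+1 < m)%N by lia.
under eq_bigr => i _ do rewrite pencil_entry_left // mulrN opprK mulrDr.
rewrite big_split /= !(sum_delta _ (fun i => V (idx b i))).
rewrite (_ : (m + (m - j.+1) < 2 * m)%N); last by lia.
rewrite mulrC; congr (_ + _); case: j jm mj => [|j] jm _.
  by rewrite (_ : (m + (m - 1).+1 < 2 * m)%N = false) //; lia.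
rewrite (_ : (m + (m - j.+2).+1 < 2 * m)%N); last by lia.
by rewrite mulrC (_ : (m - j.+2).+1 = (m - j.+1)%N) //; lia.
Qed.

End BlockPencil.

(** The second half of a block is numbered from its end, to match [left_recurrence]. *)
Lemma block_index s k : (k < sumn (shape_of s))%N -> all is_jordan s ->
  exists b mu m, [/\ (b < size s)%N, nth (JKKron 0) s b = JKJordan mu m &
    exists2 j, (j < m)%N & k = flatten_index (shape_of s) b j \/
                          k = flatten_index (shape_of s) b (m + (m - j.+1))].
Proof.
move=> ks /(all_nthP (JKKron 0)) sJ; have := reshape_indexP ks; rewrite size_map => bs.
have := reshape_offsetP ks; rewrite nth_shape => ob.
have := sJ _ bs; case E : nth ob => [mu m|] //= om _.
exists (reshape_index (shape_of s) k), mu, m; split=> //.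
set o := reshape_offset _ k in om; have [lt_om|le_mo] := ltnP o m.
  by exists o => //; left; rewrite reshape_indexK.
exists (2 * m - o.+1)%N; first by lia.
right; rewrite -[LHS](reshape_indexK (shape_of s)) -/o; congr flatten_index; lia.
Qed.

(** * Pole orders in the inverse of a block-diagonal pencil *)

Section BlockInverse.
Variables (s : seq jkblock).
Hypothesis s_jordan : all is_jordan s.
Notation n := (sumn (shape_of s)).
Notation idx b i := (flatten_index (shape_of s) b i).
Notation blk b := (nth (JKKron 0) s b).
Let M : 'M[{poly C}]_n := pencil (blockdiag_mx n blockA s) (blockdiag_mx n blockB s).

Definition nat_row (v : 'rV[{poly C}]_n) (k : nat) : {poly C} :=
  oapp (v 0) 0 (insub k).

Lemma nat_rowE v (k : 'I_n) : nat_row v k = v 0 k.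
Proof. by rewrite /nat_row valK. Qed.

Lemma nat_row_mul v (c : 'I_n) : (v *m M) 0 c =
  \sum_(k < n) nat_row v k * ((blockdiag blockA s k c)%:P - 'X * (blockdiag blockB s k c)%:P).
Proof. by rewrite mxE; apply: eq_bigr => k _; rewrite nat_rowE pencilE !mxE. Qed.

Lemma pencil_det_neq0 : \det M != 0.
Proof.
apply/det0P => -[v /eqP v0 vM]; apply: v0; apply/rowP => k; rewrite mxE -nat_rowE.
have VM0 c : (c < n)%N -> \sum_(k < n) nat_row v k *
    ((blockdiag blockA s k c)%:P - 'X * (blockdiag blockB s k c)%:P) = 0.
  by move=> cn; rewrite -(nat_row_mul v (Ordinal cn)) vM mxE.
have [b [mu [m [bs bE [j jm kE]]]]] := block_index (ltn_ord k) s_jordan.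
have shb : nth 0 (shape_of s) b = (2 * m)%N by rewrite nth_shape bE.
case: kE => ->.
  apply: (recurrence_zero (right_recurrence (nat_row v) bE)) jm => [|i im].
    exact: eig_factor_neq0.
  by apply/VM0/flatten_indexP; rewrite shb; lia.
apply: (@recurrence_zero m _ _ (fun j => nat_row v (idx b (m + (m - j.+1)))) _
  (left_recurrence (nat_row v) bE) _ _ j jm) => [|i im]; first exact: eig_factor_neq0.
by rewrite VM0 ?oppr0 //; apply/flatten_indexP; rewrite shb; lia.
Qed.

Lemma idx_inj b b' mu mu' m m' i i' : blk b = JKJordan mu m -> blk b' = JKJordan mu' m' ->
  (i < 2 * m)%N -> (i' < 2 * m')%N -> idx b i = idx b' i' -> b = b' /\ i = i'.
Proof.
move=> bE b'E im im'.
have shb : (i < nth 0 (shape_of s) b)%N by rewrite nth_shape bE.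
have shb' : (i' < nth 0 (shape_of s) b')%N by rewrite nth_shape b'E.
move=> E; have := flatten_indexKl shb; have := flatten_indexKr shb.
by rewrite E flatten_indexKl // flatten_indexKr.
Qed.

Lemma idx_lt b mu m i : blk b = JKJordan mu m -> (i < 2 * m)%N -> (idx b i < n)%N.
Proof. by move=> bE im; apply: flatten_indexP; rewrite nth_shape bE. Qed.

Variables (W : 'M[{poly C}]_n) (d : {poly C}).
Hypothesis d0 : d != 0.
Hypothesis WM : W *m M = d%:M.
Let S (p : 'I_n) := nat_row (row p W).

Let SM p c : (c < n)%N -> \sum_(k < n) S p k *
    ((blockdiag blockA s k c)%:P - 'X * (blockdiag blockB s k c)%:P) =
  if nat_of_ord p == c then d else 0.
Proof.
move=> cn; rewrite -(nat_row_mul (row p W) (Ordinal cn)) -row_mul WM !mxE.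
by rewrite -(inj_eq val_inj) /=; case: eqP.
Qed.

Lemma cross_block_zero p b mu m : blk b = JKJordan mu m ->
  (forall i, (i < 2 * m)%N -> nat_of_ord p <> idx b i) ->
  forall i, (i < 2 * m)%N -> S p (idx b i) = 0.
Proof.
move=> bE pb i i2m; have h0 c : (c < 2 * m)%N -> \sum_(k < n) S p k *
    ((blockdiag blockA s k (idx b c))%:P - 'X * (blockdiag blockB s k (idx b c))%:P) = 0.
  by move=> cm; rewrite SM ?(idx_lt bE) //; case: eqP => // /(pb _ cm).
have [im|im] := ltnP i m.
  apply: (recurrence_zero (right_recurrence (S p) bE)) im => [|j jm].
    exact: eig_factor_neq0.
  by rewrite h0 //; lia.
have -> : i = (m + (m - (2 * m - i.+1).+1))%N by lia.
apply: (@recurrence_zero m _ _ (fun j => S p (idx b (m + (m - j.+1)))) _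
  (left_recurrence (S p) bE)) => [|j jm|]; [exact: eig_factor_neq0 | | lia].
by rewrite h0 ?oppr0 //; lia.
Qed.

(** The full pole of order [m] sits in this corner: row [p] feeds [d] into the recurrence at its
    first equation only, and each later equation divides by -(l - 'X). *)
Lemma corner_entry p b l m : blk b = JKJordan (Some l) m -> (0 < m)%N ->
  nat_of_ord p = idx b m ->
  d = (l%:P - 'X) * (- (l%:P - 'X)) ^+ m.-1 * S p (idx b m.-1).
Proof.
move=> bE m0 pE; have m2 : (m + 0 < 2 * m)%N by lia.
rewrite -(recurrence_solve (right_recurrence (S p) bE)) //=; last by lia.
  by rewrite SM ?(idx_lt bE) // addn0 pE eqxx.
move=> j jm; rewrite SM ?(idx_lt bE) //; last by lia.
case: eqP => //; rewrite pE => E; have [] := idx_inj bE bE _ _ E; lia.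
Qed.

(** Inverses of the blocks with eigenvalue l have poles of order at most [m] there, and those of the
    other blocks have none, so one factor of [d] survives in every entry. *)
Lemma inverse_dvd l m :
    (forall b m', blk b = JKJordan (Some l) m' -> (m' <= m)%N) ->
    (l%:P - 'X) ^+ m.+1 %| d ->
  forall p k, l%:P - 'X %| W p k.
Proof.
move=> max_m td p k; set t := l%:P - 'X in td *.
have t0 : t != 0 by apply: (eig_factor_neq0 (Some l)).
rewrite -[W p k](_ : S p k = _); last by rewrite /S nat_rowE mxE.
have hd c : (c < n)%N -> t ^+ m.+1 %| \sum_(k < n) S p k *
    ((blockdiag blockA s k c)%:P - 'X * (blockdiag blockB s k c)%:P).
  by move=> cn; rewrite SM //; case: eqP => _; rewrite ?dvdp0.
have [b [mu [m' [bs bE [j jm kE]]]]] := block_index (ltn_ord k) s_jordan.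
have hd1 i : (i < m')%N -> t ^+ m.+1 %| \sum_(k < n) S p k *
    ((blockdiag blockA s k (idx b (m' + i)))%:P -
      'X * (blockdiag blockB s k (idx b (m' + i)))%:P).
  by move=> im; apply: hd; apply: (idx_lt bE); lia.
have hd2 i : (i < m')%N -> t ^+ m.+1 %| - \sum_(k < n) S p k *
    ((blockdiag blockA s k (idx b (m' - i.+1)))%:P -
      'X * (blockdiag blockB s k (idx b (m' - i.+1)))%:P).
  by move=> im; rewrite dvdpNr; apply: hd; apply: (idx_lt bE); lia.
have [mul|mul] := eqVneq mu (Some l).
  rewrite mul in bE; have m'm := max_m _ _ bE.
  have tdvd x : t ^+ (m.+1 - j.+1) %| x -> t %| x.
    by apply: dvdp_trans; rewrite -{1}[t]expr1; apply: dvdp_exp2l; lia.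
  case: kE => ->; apply: tdvd.
    exact: (recurrence_dvd (right_recurrence (S p) bE) t0 (leqW m'm) hd1 jm).
  exact: (@recurrence_dvd m' _ _ (fun j => S p (idx b (m' + (m' - j.+1)))) _
    (left_recurrence (S p) bE) _ t0 (leqW m'm) hd2 j jm).
have co : coprimep (t ^+ m.+1) (eig_factor mu).
  apply: coprimep_expl; case: mu mul {bE} => [l'|] /= mul; last exact: coprimep1.
  rewrite /t -[l%:P - 'X]opprB -[l'%:P - 'X]opprB -[- ('X - l%:P)]scaleN1r.
  rewrite -[- ('X - l'%:P)]scaleN1r coprimepZl ?coprimepZr ?oppr_eq0 ?oner_neq0 //.
  rewrite coprimep_XsubC root_XsubC; apply: contraNneq mul => ->; exact: eqxx.
have tdvd x : t ^+ m.+1 %| x -> t %| x.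
  by apply: dvdp_trans; rewrite exprS dvdp_mulr.
case: kE => ->; apply: tdvd.
  exact: (recurrence_dvd_coprime (right_recurrence (S p) bE) co hd1 jm).
exact: (@recurrence_dvd_coprime m' _ _ (fun j => S p (idx b (m' + (m' - j.+1)))) _
  (left_recurrence (S p) bE) _ co hd2 j jm).
Qed.

(** Entries across the two blocks vanish, so the Plücker relation makes the product of the two
    corners zero at l. A zero corner gives [d] one factor l - 'X more than the largest pole, and
    [inverse_dvd] then annihilates all of [W] at l. *)
Lemma equal_blocks l m b b' : b != b' -> (0 < m)%N ->
    blk b = JKJordan (Some l) m -> blk b' = JKJordan (Some l) m ->
    (forall b'' m', blk b'' = JKJordan (Some l) m' -> (m' <= m)%N) ->
  root d l /\ ((exists u w : 'rV_n, map_mx (horner_eval l) W = u^T *m w - w^T *m u) ->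
    map_mx (horner_eval l) W = 0).
Proof.
move=> bb' m0 bE b'E max_m; set t := l%:P - 'X.
have m2 : (m < 2 * m)%N by lia.
have m1 : (m.-1 < 2 * m)%N by lia.
pose p := Ordinal (idx_lt bE m2); pose p' := Ordinal (idx_lt b'E m2).
pose q := Ordinal (idx_lt bE m1); pose q' := Ordinal (idx_lt b'E m1).
have dE := corner_entry bE m0 (erefl : nat_of_ord p = _).
have d'E := corner_entry b'E m0 (erefl : nat_of_ord p' = _).
have SE x y : S x (nat_of_ord y) = W x y by rewrite /S nat_rowE mxE.
rewrite -/t -[idx _ _]/(nat_of_ord q) SE in dE.
rewrite -/t -[idx _ _]/(nat_of_ord q') SE in d'E.
have tl : t.[l] = 0 by rewrite /t !hornerE subrr.
split; first by rewrite dE /root !hornerM tl !mul0r.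
case=> u [w WE].
have Wl x y : (W x y).[l] = u 0 x * w 0 y - w 0 x * u 0 y.
  by have /matrixP/(_ x y) := WE; rewrite !mxE !big_ord1 !mxE.
have cross y i : (i < 2 * m)%N -> nat_of_ord y = idx b' i -> W p y = 0.
  move=> im yE; rewrite -SE yE; apply: (cross_block_zero b'E) => // i' i'm E.
  by have [/eqP] := idx_inj bE b'E m2 i'm E; rewrite (negPf bb').
have Wpp' : W p p' = 0 := cross p' m m2 erefl.
have Wpq' : W p q' = 0 := cross q' m.-1 m1 erefl.
have : (W p q).[l] * (W p' q').[l] = 0.
  transitivity ((W p p').[l] * (W q q').[l] - (W p q').[l] * (W q p').[l]).
    by rewrite !Wl; ring.
  by rewrite Wpp' Wpq' horner0 !mul0r subr0.
have tdvd z : z.[l] = 0 -> d = t * (- t) ^+ m.-1 * z -> t ^+ m.+1 %| d.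
  move=> zl ->; rewrite exprSr dvdp_mul //.
    rewrite -{1}[m]prednK // exprS dvdp_mul // exprNn dvdp_mull //.
  by rewrite /t -[l%:P - 'X]opprB -[- ('X - l%:P)]scaleN1r dvdpZl ?oppr_eq0 ?oner_neq0 // dvdp_XsubCl /root zl.
move=> /eqP; rewrite mulf_eq0 => /orP[] /eqP z.
  all: apply/matrixP => x y; rewrite !mxE /horner_eval; apply/eqP.
  all: have := inverse_dvd max_m (tdvd _ z _) x y.
  all: rewrite -[l%:P - 'X]opprB -[- ('X - l%:P)]scaleN1r dvdpZl ?oppr_eq0 ?oner_neq0 // dvdp_XsubCl; apply.
all: by [].
Qed.

End BlockInverse.

(** * Uniqueness of the maximum *)

Lemma C_natr_inj (i j : nat) : (i%:R : C) = j%:R -> i = j.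
Proof.
wlog lij : i j / (i <= j)%N => [H|] E.
  by have [/H|/ltnW/H H'] := leqP i j; [apply | apply/esym/H'].
apply/eqP; rewrite eqn_leq lij /= leqNgt; apply/negP => ltij.
have : ((j - i)%:R : C) == 0 by rewrite natrB // E subrr.
have := subn_gt0 i j; rewrite ltij; case: (j - i)%N => // k _.
by rewrite (negPf (C_char0 k)).
Qed.

Lemma poly_nonroot (p : {poly C}) : p != 0 -> exists x, p.[x] != 0.
Proof.
move=> p0; pose r : seq C := [seq k%:R | k <- iota 0 (size p)].
have [/allP pr|] := boolP (all (root p) r); last first.
  by case/allPn => x _ px; exists x.
suff ur : uniq r.
  by have := max_poly_roots p0 (introT allP pr) ur; rewrite size_map size_iota ltnn.
by rewrite map_inj_uniq ?iota_uniq //; apply: C_natr_inj.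
Qed.

Lemma digits_inj N n (f h : 'I_n -> nat) :
    (forall i, f i < N)%N -> (forall i, h i < N)%N ->
  (\sum_(i < n) f i * N ^ i = \sum_(i < n) h i * N ^ i)%N -> f =1 h.
Proof.
elim: n f h => [|n IH] f h fN hN; first by move=> _ [].
have split_sum (e : 'I_n.+1 -> nat) : (\sum_(i < n.+1) e i * N ^ i =
    (\sum_(i < n) e (lift ord0 i) * N ^ i) * N + e ord0)%N.
  rewrite big_ord_recl /= expn0 muln1 addnC big_distrl /=; congr (_ + _)%N.
  by apply: eq_bigr => i _; rewrite -mulnA -expnSr.
have N0 : (0 < N)%N by apply: leq_ltn_trans (fN ord0).
rewrite !split_sum => E.
have E0 : f ord0 = h ord0.
  have := congr1 (modn^~ N) E; rewrite /= !modnMDl !modn_small //.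
have E1 : (\sum_(i < n) f (lift ord0 i) * N ^ i = \sum_(i < n) h (lift ord0 i) * N ^ i)%N.
  by have := congr1 (divn^~ N) E; rewrite /= !divnMDl // !divn_small // !addn0.
have {}IH := IH _ _ (fun i => fN (lift ord0 i)) (fun i => hN (lift ord0 i)) E1.
move=> i; have [j ->|->] := unliftP ord0 i; [exact: IH | exact: E0].
Qed.

(* Kronecker substitution [X_i := X^(N^i)] with [N] larger than all exponents. *)
Lemma mpoly_nonroot n (p : {mpoly C[n]}) : p != 0 -> exists v, meval v p != 0.
Proof.
move=> p0; pose N := msize p; pose code (m : 'X_{1..n}) := (\sum_(i < n) m i * N ^ i)%N.
have code_inj m m' : m \in msupp p -> m' \in msupp p -> code m = code m' -> m = m'.
  have digit (m1 : 'X_{1..n}) i : m1 \in msupp p -> (m1 i < N)%N.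
    move=> m1p; apply: leq_ltn_trans (msize_mdeg_lt m1p).
    by rewrite mdegE (bigD1 i) //= leq_addr.
  move=> mp m'p E; apply/mnmP; apply: digits_inj E => i; exact: digit.
pose q : {poly C} := \sum_(m <- msupp p) p@_m *: 'X^(code m).
have q0 : q != 0.
  have : msupp p != [::] by rewrite msupp_eq0.
  case E : (msupp p) => [|m0 r] // _; apply: contraT; rewrite negbK => /eqP.
  move=> /(congr1 (fun q : {poly C} => q`_(code m0))); rewrite coef0 /q coef_sum.
  have m0p : m0 \in msupp p by rewrite E mem_head.
  rewrite (bigD1_seq m0) //= big1_seq => [|m /andP[mm0 mp]].
    rewrite addr0 coefZ coefXn eqxx mulr1 => /eqP.
    by rewrite mcoeff_eq0 m0p.
  rewrite coefZ coefXn; case: eqP => [/esym/(code_inj _ _ mp m0p) mE|_]; last by rewrite mulr0.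
  by rewrite mE eqxx in mm0.
have [x qx] := poly_nonroot q0; exists (fun i => x ^+ (N ^ i)).
apply: contraNneq qx => E; rewrite -E mevalE /q horner_sum; apply/eqP/eq_bigr => m _.
rewrite hornerZ hornerXn; congr (_ * _); rewrite /code -prodrXr.
by apply: eq_bigr => i _; rewrite -exprM mulnC.
Qed.

(** On a line, nonvanishing conditions become conditions on polynomials in one variable, so two of
    them can be met at a common point of the line joining their witnesses. *)
Lemma meval_line n (f : {mpoly C[n]}) (v w : 'I_n -> C) :
  exists q : {poly C}, forall t, q.[t] = meval (fun i => v i + t * w i) f.
Proof.
exists (\sum_(m <- msupp f) f@_m *: \prod_i ((v i)%:P + 'X * (w i)%:P) ^+ m i) => t.
rewrite horner_sum mevalE; apply: eq_bigr => m _; rewrite hornerZ horner_prod.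
by congr (_ * _); apply: eq_bigr => i _; rewrite horner_exp !hornerE.
Qed.

Lemma count_two (T : Type) (x0 : T) (P : pred T) s : (1 < count P s)%N ->
  exists i j, [/\ i != j, (i < size s)%N, (j < size s)%N, P (nth x0 s i) & P (nth x0 s j)].
Proof.
elim: s => // x s IH /=; case Px : (P x) => /=.
  rewrite add1n ltnS -has_count => Ps.
  exists 0%N, (find P s).+1; split=> //=; first by rewrite ltnS -has_find.
  exact: nth_find.
by rewrite add0n => /IH[i [j [ij is_ js Pi Pj]]]; exists i.+1, j.+1; split.
Qed.

Lemma kron_sizes_nil s : perm_eq (kron_sizes s) [::] -> all is_jordan s.
Proof.
by move/perm_nilP; elim: s => //= b s IH; case: b => [mu m|k] //=; apply: IH.
Qed.

Lemma sumn_shape_of s : sumn (shape_of s) = (\sum_(b <- s) jk_size b)%N.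
Proof. by rewrite sumnE big_map. Qed.

Lemma pencil_congr n (P A B : 'M[C]_n) :
  map_mx polyC P *m pencil A B *m (map_mx polyC P)^T = pencil (P *m A *m P^T) (P *m B *m P^T).
Proof.
by rewrite /pencil mulmxBr mulmxBl !map_mxM map_trmx -scalemxAr -scalemxAl.
Qed.

Lemma JK_pencil_det n (A B : 'M[C]_n) s :
  JK_decomposition A B s -> all is_jordan s -> \det (pencil A B) != 0.
Proof.
case=> _ [nE [P [_ [PA PB]]]] sJ; rewrite -sumn_shape_of in nE; subst n.
have := pencil_det_neq0 sJ; rewrite -PA -PB -pencil_congr !det_mulmx.
by rewrite !mulf_eq0 !negb_or -andbA => /and3P[].
Qed.

(** The first column of the nilpotent matrix J_0 is zero, so an infinite block makes [B]
    singular. *)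
Lemma JK_no_infinite n (A B : 'M[C]_n) s b m :
    JK_decomposition A B s -> all is_jordan s -> \det B != 0 ->
  nth (JKKron 0) s b <> JKJordan None m.
Proof.
case=> sv [nE [P [Pu [_ PB]]]] sJ B0 bE; rewrite -sumn_shape_of in nE; subst n.
have bs : (b < size s)%N.
  by rewrite ltnNge; apply/negP => sb; rewrite nth_default in bE.
have m0 : (0 < m)%N by have /(all_nthP (JKKron 0))/(_ b bs) := sv; rewrite bE.
have m2 : (m < 2 * m)%N by lia.
pose c := Ordinal (idx_lt bE m2).
have := congr1 determinant PB; rewrite !det_mulmx det_tr.
rewrite (expand_det_col (blockdiag_mx _ blockB s) c) big1 => [/eqP|k _].
  by rewrite unitmxE unitfE in Pu; rewrite !mulf_eq0 (negPf B0) (negPf Pu).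
rewrite mxE; have [b' [mu [m' [_ b'E [j jm kE]]]]] := block_index (ltn_ord k) sJ.
have [i im' ->] : exists2 i, (i < 2 * m')%N & nat_of_ord k = flatten_index (shape_of s) b' i.
  by case: kE => ->; [exists j | exists (m' + (m' - j.+1))%N] => //; lia.
rewrite blockdiag_flatten ?nth_shape ?b'E ?bE //; case: eqP => [b'b|_]; last by rewrite mul0r.
move: b'E; rewrite b'b bE => -[<- mm']; rewrite -mm' in im' *.
rewrite /= /skew_of ltnn leqnn andbF subnn /jordan_entry.
by case: ifP => _; case: i im' => [|i] im'; rewrite ?mul0r // if_same ?mul0r.
Qed.

Lemma JK_equal_blocks n (A B : 'M[C]_n) s (W : 'M[{poly C}]_n) d l m b b' :
    JK_decomposition A B s -> all is_jordan s ->
    d != 0 -> W *m pencil A B = d%:M ->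
    b != b' -> nth (JKKron 0) s b = JKJordan (Some l) m ->
    nth (JKKron 0) s b' = JKJordan (Some l) m ->
    (forall b'' m', nth (JKKron 0) s b'' = JKJordan (Some l) m' -> (m' <= m)%N) ->
  root d l /\ ((exists u w : 'rV_n, map_mx (horner_eval l) W = u^T *m w - w^T *m u) ->
    map_mx (horner_eval l) W = 0).
Proof.
case=> sv [nE [P [Pu [PA PB]]]] sJ d0 WM bb' bE b'E max_m.
rewrite -sumn_shape_of in nE; subst n.
have bs : (b < size s)%N.
  by rewrite ltnNge; apply/negP => sb; rewrite nth_default in bE.
have m0 : (0 < m)%N by have /(all_nthP (JKKron 0))/(_ b bs) := sv; rewrite bE.
pose Q := invmx P; pose Q' := map_mx polyC Q; pose P' := map_mx polyC P.
have QP : Q' *m P' = 1%:M by rewrite -map_mxM mulVmx // map_scalar_mx.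
have PQ : P' *m Q' = 1%:M by rewrite -map_mxM mulmxV // map_scalar_mx.
(* The inverse transforms contragrediently; a decomposable value stays decomposable, with [u] and
   [w] multiplied by [Q]. *)
pose W' := Q'^T *m W *m Q'.
have W'M : W' *m pencil (blockdiag_mx _ blockA s) (blockdiag_mx _ blockB s) = d%:M.
  rewrite -PA -PB -pencil_congr /W' -!mulmxA [Q' *m _]mulmxA QP mul1mx.
  rewrite [W *m _]mulmxA WM mul_scalar_mx -scalemxAr -trmx_mul PQ trmx1.
  by rewrite scale_scalar_mx mulr1.
have [dl W'0] := equal_blocks sJ d0 W'M bb' m0 bE b'E max_m.
split=> // -[u [w Wl]].
have evW' : map_mx (horner_eval l) W' = Q^T *m map_mx (horner_eval l) W *m Q.
  have evQ : map_mx (horner_eval l) Q' = Q.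
    by apply/matrixP => i j; rewrite !mxE /horner_eval hornerC.
  by rewrite !map_mxM -map_trmx evQ.
have : map_mx (horner_eval l) W' = 0.
  apply: W'0; exists (u *m Q), (w *m Q).
  by rewrite evW' Wl mulmxBr mulmxBl !trmx_mul !mulmxA.
rewrite evW' => /(congr1 (fun X => P^T *m X *m P)).
rewrite mulmx0 mul0mx !mulmxA -trmx_mul -[LHS]mulmxA mulVmx // mulmx1.
by rewrite trmx1 mul1mx.
Qed.

Lemma regular_direction n (g : lie_algebra n) x0 a0 s :
    JK_decomposition (form_A g x0) (form_A g a0) s -> all is_jordan s ->
  exists y, \det (form_A g y) != 0.
Proof.
move=> /JK_pencil_det H /H /poly_nonroot[l]; rewrite -horner_evalE -det_map_mx => dl.
exists ((- l) *: a0 + x0); apply: contraNneq dl => y0; apply/eqP.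
rewrite -[RHS]y0 form_A_linear; congr determinant; apply/matrixP => p q.
rewrite mxE pencilE !mxE; move: (pairing x0 _) (pairing a0 _) => b c.
by rewrite /= /horner_eval !hornerE; ring.
Qed.

(** * Choice of a generic point, and the contradiction *)

Section Necessity.
Variables (n : nat) (g : lie_algebra n) (T : seq (seq nat)).

(** [a] is chosen before [x] because the polynomial provided by [generic_pole] depends on [a]. *)
Lemma generic_point : JK_invariants g [::] T ->
  exists x a s, [/\ JK_decomposition (form_A g x) (form_A g a) s, all is_jordan s,
    perm_eq (jordan_tuples s) T, \det (form_A g a) != 0 &
    exists (W : 'M[{poly C}]_n) (d : {poly C}),
    [/\ d != 0, W *m pencil (form_A g x) (form_A g a) = d%:M &
      forall l, root d l -> map_mx (horner_eval l) W != 0 /\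
        exists u w : 'rV_n, map_mx (horner_eval l) W = u^T *m w - w^T *m u]].
Proof.
case=> U [[fs fsU] [[x0 [a0 Ux0]] JK]].
have [f f_fs f0] := hasP (iffLR (fsU x0 a0) Ux0).
have fU x a : meval (point x a) f != 0 -> U x a.
  by move=> fxa; apply/fsU/hasP; exists f.
have [s0 [JK0 [/kron_sizes_nil s0J _]]] := JK _ _ Ux0.
have [y y0] := regular_direction JK0 s0J.
(* On the line from [a0] to [y], [f] is nonzero at t = 0 and the determinant at t = 1. The choice of
   [x] below uses the line from [x0] to [x1] in the same way, with [Delta] at t = 1. *)
have [a fa da] : exists2 a, meval (point x0 a) f != 0 & \det (form_A g a) != 0.
  have [q qE] := meval_line f (point x0 a0) (point 0 (y - a0)).
  pose r := \det (pencil (form_A g a0) (form_A g (a0 - y))).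
  have rE t : r.[t] = \det (form_A g (a0 + t *: (y - a0))).
    rewrite /r -horner_evalE -det_map_mx; congr determinant.
    have -> : a0 + t *: (y - a0) = (- t) *: (a0 - y) + a0.
      by rewrite scaleNr -scalerN opprB addrC.
    rewrite form_A_linear.
    apply/matrixP => p p'; rewrite mxE pencilE !mxE.
    move: (pairing a0 _) (pairing (a0 - y) _) => b c.
    by rewrite /= /horner_eval !hornerE; ring.
  have qa t : q.[t] = meval (point x0 (a0 + t *: (y - a0))) f.
    rewrite qE; apply: meval_eq => i; rewrite /point -(splitK i); case: (split i) => j /=.
      by rewrite !row_mxEl mxE mulr0 addr0.
    by rewrite !row_mxEr !mxE.
  have q0 : q != 0.
    by apply: contraNneq f0 => q0; have := qa 0; rewrite q0 horner0 scale0r addr0 => <-.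
  have r0 : r != 0.
    apply: contraNneq y0 => r0; have := rE 1.
    by rewrite r0 horner0 scale1r addrC subrK => <-.
  have [t] := poly_nonroot (mulf_neq0 q0 r0); rewrite hornerM mulf_eq0 negb_or.
  by rewrite qa rE => /andP[]; exists (a0 + t *: (y - a0)).
have [Delta Delta0 DeltaP] := generic_pole da.
have [v Dv] := mpoly_nonroot Delta0; pose x1 := \row_i v i.
have {}Dv : meval (x1 0) Delta != 0.
  by rewrite (@meval_eq _ _ _ v) // => i; rewrite mxE.
have [x fx Dx] : exists2 x : 'rV_n, meval (point x a) f != 0 & meval (x 0) Delta != 0.
  have [q qE] := meval_line f (point x0 a) (point (x1 - x0) 0).
  have [r rE] := meval_line Delta (x0 0) ((x1 - x0) 0).
  have rx t : r.[t] = meval ((x0 + t *: (x1 - x0)) 0) Delta.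
    by rewrite rE; apply: meval_eq => i; rewrite !mxE.
  have qx t : q.[t] = meval (point (x0 + t *: (x1 - x0)) a) f.
    rewrite qE; apply: meval_eq => i; rewrite /point -(splitK i); case: (split i) => j /=.
      by rewrite !row_mxEl !mxE.
    by rewrite !row_mxEr mxE mulr0 addr0.
  have q0 : q != 0.
    by apply: contraNneq fa => q0; have := qx 0; rewrite q0 horner0 scale0r addr0 => <-.
  have r0 : r != 0.
    apply: contraNneq Dv => r0; have := rx 1.
    by rewrite r0 horner0 scale1r addrC subrK => <-.
  have [t] := poly_nonroot (mulf_neq0 q0 r0); rewrite hornerM mulf_eq0 negb_or.
  by rewrite qx rx => /andP[]; exists (x0 + t *: (x1 - x0)).
have [s [JKs [/kron_sizes_nil sJ sT]]] := JK _ _ (fU _ _ fx).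
by exists x, a, s; split=> //; apply: DeltaP.
Qed.

Lemma unique_maximum t : JK_invariants g [::] T -> [seq 2 * k | k <- t]%N \in T ->
    t != [::] -> sorted geq t ->
  size t = 1%N \/ (nth 0 t 1 < nth 0 t 0)%N.
Proof.
move=> /generic_point[x [a [s [JKs sJ sT da [W [d [d0 WM Wl]]]]]]] tT t0 tsort.
case: t tT t0 tsort => // k [|k' t] tT _ tsort; [by left | right].
have /andP[k'k _] := tsort; rewrite /= ltn_neqAle [(k' <= k)%N]k'k andbT.
apply/eqP => kk'; rewrite -{}kk' in tT tsort *.
move: tT; rewrite -(perm_mem sT) => /mapP[mu _ muE].
have sizes_mu : perm_eq [seq jk_size b | b <- s &
    if b is JKJordan mu' _ then mu' == mu else false]
    [seq 2 * i | i <- k' :: k' :: t]%N.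
  by rewrite muE /jordan_tuple perm_sym perm_sort.
have max_k b m : nth (JKKron 0) s b = JKJordan mu m -> (m <= k')%N.
  move=> bE; have bs : (b < size s)%N.
    by rewrite ltnNge; apply/negP => sb; rewrite nth_default in bE.
  have : (2 * m)%N \in [seq 2 * i | i <- k' :: k' :: t]%N.
    rewrite -(perm_mem sizes_mu) -[(2 * m)%N]/(jk_size (JKJordan mu m)) -bE.
    elim: {sJ sT JKs muE sizes_mu} s b bE bs => [|b' s IH] [|b] //= bE.
      by rewrite bE eqxx /= mem_head.
    rewrite ltnS => bs; have := IH b bE bs.
    by case: ifP => _ //; rewrite inE => ->; rewrite orbT.
  case/mapP => j jt /eqP; rewrite eqn_pmul2l // => /eqP ->.
  have ltr : transitive geq by move=> y1 y2 y3 h1 h2; apply: leq_trans h2 h1.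
  have /allP kt : all (geq k') (k' :: t) := order_path_min ltr tsort.
  move: jt; rewrite inE => /predU1P[->//|]; exact: kt.
have [b [b' [bb' bs b's Pb Pb']]] : exists b b', [/\ b != b', (b < size s)%N,
    (b' < size s)%N, nth (JKKron 0) s b = JKJordan mu k' &
    nth (JKKron 0) s b' = JKJordan mu k'].
  pose P b := (if b is JKJordan mu' _ then mu' == mu else false) && (jk_size b == 2 * k')%N.
  have PE b : P b -> b = JKJordan mu k'.
    by case: b => [mu' m|] //= /andP[/eqP -> /eqP/eqP]; rewrite eqn_pmul2l // => /eqP ->.
  have : (1 < count P s)%N.
    have /seq.permP/(_ (pred1 (2 * k')%N)) := sizes_mu; rewrite count_map count_filter.
    rewrite /= eqxx add1n (_ : count _ s = count P s) => [->|]; first by [].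
    by apply: eq_count => b; rewrite /P /= andbC.
  case/(count_two (JKKron 0)) => b [b' [bb' bs b's /PE Pb /PE Pb']].
  by exists b, b'; split.
(* A regular [a] excludes the infinite eigenvalue. At a finite one the equal blocks force [W] to
   vanish at a pole, which [generic_point] forbids. *)
case: mu {muE sizes_mu} Pb Pb' max_k => [l|] Pb Pb' max_k; last first.
  exact: (JK_no_infinite JKs sJ da Pb).
have [dl Wl0] := JK_equal_blocks JKs sJ d0 WM bb' Pb Pb' max_k.
have [/eqP W0 uw] := Wl l dl; exact/W0/Wl0.
Qed.

End Necessity.

(** * A Lie algebra realizing given tuples *)

(* The commutative algebra has basis [u_(b,i)] for [i < nth 0 ms b]: the block
   [hd b] is the truncated polynomial algebra of its tuple, the other blocks of
   the tuple are truncated modules over it with trivial products. *)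
Section Construction.
Variables (ms : seq nat) (hd : nat -> nat).
Hypothesis hdK : forall b, (b < size ms)%N -> hd (hd b) = hd b.
Hypothesis hd_le : forall b, (b < size ms)%N -> (hd b <= b)%N.
Hypothesis hd_size : forall b, (b < size ms)%N -> hd b != b ->
  (nth 0 ms b < nth 0 ms (hd b))%N.
Hypothesis ms_pos : forall b, (b < size ms)%N -> (0 < nth 0 ms b)%N.
Notation N := (sumn ms).
Implicit Types (r d : 'I_N) (x y a : 'rV[C]_N).

Definition ord_block r : nat := reshape_index ms r.
Definition ord_offset r : nat := reshape_offset ms r.

Lemma ord_block_lt r : (ord_block r < size ms)%N. Proof. exact: reshape_indexP. Qed.

Lemma ord_offset_lt r : (ord_offset r < nth 0 ms (ord_block r))%N. Proof. exact: reshape_offsetP. Qed.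

Lemma ord_block_offset_inj r r' : ord_block r = ord_block r' -> ord_offset r = ord_offset r' -> r = r'.
Proof.
move=> B O; apply: val_inj; rewrite /= -(reshape_indexK ms r) -(reshape_indexK ms r').
by rewrite -!/(ord_block _) -!/(ord_offset _) B O.
Qed.

Lemma leq_nth_hd b : (b < size ms)%N -> (nth 0 ms b <= nth 0 ms (hd b))%N.
Proof. by move=> bs; case: (eqVneq (hd b) b) => [->|/(hd_size bs)/ltnW]. Qed.

Lemma hd_ord_block r : hd (hd (ord_block r)) = hd (ord_block r). Proof. exact/hdK/ord_block_lt. Qed.

Lemma exists_ord b i : (i < nth 0 ms b)%N -> exists2 r, ord_block r = b & ord_offset r = i.
Proof.
move=> ib; exists (Ordinal (flatten_indexP ib)); first exact: flatten_indexKl.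
exact: flatten_indexKr.
Qed.

(* [basis_mul r1 r2 d] means [u_r1 * u_r2 = u_d]. *)
Definition basis_mul r1 r2 d : bool :=
  (ord_offset r1 + ord_offset r2 == ord_offset d)%N &&
  ((ord_block r1 == hd (ord_block d)) && (ord_block r2 == ord_block d) ||
   (ord_block r2 == hd (ord_block d)) && (ord_block r1 == ord_block d)).

Lemma basis_mul_sym r1 r2 d : basis_mul r1 r2 d = basis_mul r2 r1 d.
Proof. by rewrite /basis_mul addnC orbC. Qed.

Lemma basis_mul_fun r1 r2 d d' : basis_mul r1 r2 d -> basis_mul r1 r2 d' -> d = d'.
Proof.
case/andP=> /eqP o1 B1 /andP[/eqP o2 B2]; apply: ord_block_offset_inj; last by rewrite -o1.
have := hd_ord_block d; have := hd_ord_block d'.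
case/orP: B1 => /andP[/eqP B1 /eqP B2']; case/orP: B2 => /andP[/eqP B3 /eqP B4]; congruence.
Qed.

(** With commutativity, this exchange amounts to associativity. The intermediate product is not
    truncated too early, since no block is longer than the head of its tuple. *)
Lemma basis_mul_assoc r1 r2 r3 d : (exists2 e, basis_mul r1 r2 e & basis_mul e r3 d) ->
  exists2 e, basis_mul r1 r3 e & basis_mul e r2 d.
Proof.
case=> e /andP[/eqP o1 B1] /andP[/eqP o2 B2].
have od := ord_offset_lt d; have hdd := hd_ord_block d; have mh := leq_nth_hd (ord_block_lt d).
have [r0 r0B r0o] : exists2 r, ord_block r = ord_block d &
    ord_offset r = (ord_offset r1 + ord_offset r3)%N.
  by apply: exists_ord; lia.
have [r4 r4B r4o] : exists2 r, ord_block r = hd (ord_block d) &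
    ord_offset r = (ord_offset r1 + ord_offset r3)%N.
  by apply: exists_ord; lia.
case/orP: B2 => /andP[/eqP B2 /eqP B3].
  have B4 : ord_block r1 = hd (ord_block d) /\ ord_block r2 = hd (ord_block d).
    by rewrite B2 hdd in B1; case/orP: B1 => /andP[/eqP -> /eqP ->].
  case: B4 => B4 B5; exists r0; rewrite /basis_mul r0o r0B ?B3 ?B4 ?B5 !eqxx ?orbT ?andbT //.
  by apply/eqP; lia.
rewrite B3 in B1; case/orP: B1 => /andP[/eqP B4 /eqP B5].
  exists r4; rewrite /basis_mul r4o r4B ?B2 ?B4 ?B5 ?hdd !eqxx ?orbT ?andbT //.
  by apply/eqP; lia.
exists r0; rewrite /basis_mul r0o r0B ?B2 ?B4 ?B5 !eqxx ?orbT ?andbT //; by apply/eqP; lia.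
Qed.

(** Row [r] is the product of u_r and [x], so [y *m regular_mx x] is the product in the algebra. *)
Definition regular_mx x : 'M[C]_N := \matrix_(r, d) \sum_e x 0 e * (basis_mul r e d)%:R.

Lemma regular_mx_linear k x y : regular_mx (k *: x + y) = k *: regular_mx x + regular_mx y.
Proof.
apply/matrixP => r d; rewrite !mxE mulr_sumr -big_split; apply: eq_bigr => e _.
by rewrite !mxE /= mulrDl mulrA.
Qed.

Lemma regular_mx0 : regular_mx 0 = 0.
Proof. by apply/matrixP => r d; rewrite !mxE big1 // => e _; rewrite mxE mul0r. Qed.

Lemma mul_regular_mxC x y : x *m regular_mx y = y *m regular_mx x.
Proof.
apply/rowP => d; rewrite !mxE.
transitivity (\sum_r \sum_e x 0 r * (y 0 e * (basis_mul r e d)%:R)).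
  by apply: eq_bigr => r _; rewrite mxE mulr_sumr.
rewrite exchange_big; apply: eq_bigr => e _; rewrite mxE mulr_sumr.
by apply: eq_bigr => r _; rewrite basis_mul_sym mulrCA.
Qed.

Lemma regular_mx_comm x y : regular_mx x *m regular_mx y = regular_mx y *m regular_mx x.
Proof.
have assoc r1 r2 r3 d : \sum_e (basis_mul r1 r2 e)%:R * (basis_mul e r3 d)%:R =
    \sum_e (basis_mul r1 r3 e)%:R * (basis_mul e r2 d)%:R :> C.
  have E s2 s3 : \sum_e (basis_mul r1 s2 e)%:R * (basis_mul e s3 d)%:R =
      [exists e, basis_mul r1 s2 e && basis_mul e s3 d]%:R :> C.
    case: existsP => [[e /andP[Te Ted]]|nT].
      rewrite (bigD1 e) //= Te Ted mulr1 big1 ?addr0 // => e' e'e.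
      case Te' : (basis_mul r1 s2 e'); last by rewrite mul0r.
      by rewrite (basis_mul_fun Te' Te) eqxx in e'e.
    rewrite big1 // => e _; rewrite -natrM mulnb; case: andP => // Te.
    by case: nT; exists e; apply/andP.
  rewrite !E; congr (_%:R); congr nat_of_bool; apply/existsP/existsP => -[e /andP[T1 T2]].
    have [e' T3 T4] := basis_mul_assoc (ex_intro2 _ _ e T1 T2); exists e'; exact/andP.
  have [e' T3 T4] := basis_mul_assoc (ex_intro2 _ _ e T1 T2); exists e'; exact/andP.
have LE z w r d : (regular_mx z *m regular_mx w) r d =
    \sum_e1 \sum_e2 z 0 e1 * w 0 e2 * \sum_e (basis_mul r e1 e)%:R * (basis_mul e e2 d)%:R.
  rewrite mxE; transitivity (\sum_e \sum_e1 \sum_e2 z 0 e1 * w 0 e2 *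
      ((basis_mul r e1 e)%:R * (basis_mul e e2 d)%:R)).
    apply: eq_bigr => e _; rewrite !mxE mulr_suml; apply: eq_bigr => e1 _.
    by rewrite mulr_sumr; apply: eq_bigr => e2 _; ring.
  rewrite exchange_big; apply: eq_bigr => e1 _; rewrite exchange_big.
  by apply: eq_bigr => e2 _; rewrite mulr_sumr.
apply/matrixP => r d; rewrite !LE exchange_big; apply: eq_bigr => e1 _.
by apply: eq_bigr => e2 _; rewrite assoc [y 0 _ * _]mulrC.
Qed.

Lemma regular_mx_mul x y : regular_mx (x *m regular_mx y) = regular_mx x *m regular_mx y.
Proof.
apply/row_matrixP => r; rewrite !rowE [LHS]mul_regular_mxC -mulmxA [regular_mx y *m _]regular_mx_comm.
by rewrite [LHS]mulmxA [x *m _]mul_regular_mxC mulmxA.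
Qed.

(** Left halves are elements of the algebra, right halves functionals, acted on by the transpose of
    multiplication. Commutativity makes this an action without the usual sign. *)
Definition ext_br (z z' : 'rV[C]_(N + N)) : 'rV[C]_(N + N) :=
  row_mx 0 (rsubmx z' *m (regular_mx (lsubmx z))^T - rsubmx z *m (regular_mx (lsubmx z'))^T).

Lemma ext_br_linl k (x y z : 'rV_(N + N)) : ext_br (k *: x + y) z = k *: ext_br x z + ext_br y z.
Proof.
rewrite /ext_br scale_row_mx add_row_mx scaler0 addr0; congr row_mx.
rewrite !linearP /= regular_mx_linear linearP /= mulmxDr mulmxDl -scalemxAr -scalemxAl.
by rewrite scalerBr opprD !addrA; congr (_ + _); rewrite -!addrA; congr (_ + _); rewrite addrC.
Qed.

Lemma ext_br_alt (x : 'rV_(N + N)) : ext_br x x = 0.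
Proof. by rewrite /ext_br subrr row_mx0. Qed.

Lemma ext_brC (x y : 'rV_(N + N)) : ext_br x y = - ext_br y x.
Proof. by rewrite /ext_br opp_row_mx oppr0 opprB. Qed.

Lemma ext_br_linr k (x y z : 'rV_(N + N)) : ext_br z (k *: x + y) = k *: ext_br z x + ext_br z y.
Proof. by rewrite ext_brC ext_br_linl opprD -scalerN -!ext_brC. Qed.

Lemma ext_br_jacobi (x y z : 'rV_(N + N)) :
  ext_br x (ext_br y z) + ext_br y (ext_br z x) + ext_br z (ext_br x y) = 0.
Proof.
have E u v w : ext_br u (ext_br v w) = row_mx 0
    (rsubmx w *m (regular_mx (lsubmx u) *m regular_mx (lsubmx v))^T -
     rsubmx v *m (regular_mx (lsubmx u) *m regular_mx (lsubmx w))^T).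
  rewrite {1}/ext_br {1 2}/ext_br row_mxKl row_mxKr regular_mx0 trmx0 mulmx0 subr0.
  by rewrite mulmxBl -!mulmxA -!trmx_mul.
rewrite !E !add_row_mx !addr0 -[RHS](@row_mx0 _ 1 N N); congr row_mx.
rewrite [regular_mx (lsubmx y) *m regular_mx (lsubmx x)]regular_mx_comm.
rewrite [regular_mx (lsubmx z) *m regular_mx (lsubmx x)]regular_mx_comm.
rewrite [regular_mx (lsubmx z) *m regular_mx (lsubmx y)]regular_mx_comm.
move: (rsubmx z *m _) (rsubmx y *m _) (rsubmx x *m _) => u v w.
by apply/rowP => i; rewrite !mxE; ring.
Qed.

Definition ext_lie : lie_algebra (N + N) :=
  LieAlgebra ext_br_linl ext_br_linr ext_br_alt ext_br_jacobi.

(** Only the restriction of [x] to the dual summand matters. It is an element of the algebra, and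
    its value on h.f is [f] applied to its product with h. *)
Lemma form_ext (x : 'rV_(N + N)) :
  form_A ext_lie x = block_mx 0 (regular_mx (rsubmx x)) (- (regular_mx (rsubmx x))^T) 0.
Proof.
have lb i : basis_vec (lshift N i) = row_mx (delta_mx 0 i) 0 :> 'rV_(N + N).
  by rewrite /basis_vec delta_mx_lshift.
have rb i : basis_vec (rshift N i) = row_mx 0 (delta_mx 0 i) :> 'rV_(N + N).
  by rewrite /basis_vec delta_mx_rshift.
have pE w : pairing x (row_mx 0 w) = (rsubmx x *m w^T) 0 0.
  rewrite /pairing big_split_ord /= big1 ?add0r => [|i _].
    by rewrite mxE; apply: eq_bigr => i _; rewrite row_mxEr !mxE.
  by rewrite row_mxEl mxE mulr0.
have lr i j : form_A ext_lie x (lshift N i) (rshift N j) = regular_mx (rsubmx x) i j.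
  rewrite mxE lb rb /= /ext_br !row_mxKl !row_mxKr regular_mx0 trmx0 mulmx0 subr0 pE.
  rewrite trmx_mul trmxK mulmxA mul_regular_mxC -rowE.
  by rewrite trmx_delta -colE !mxE.
apply/matrixP => p q; rewrite -(splitK p) -(splitK q).
case: (split p) => i; case: (split q) => j /=.
- by rewrite block_mxEul mxE lb lb /= /ext_br !row_mxKr !mul0mx subr0 row_mx0 mxE
    /pairing big1 // => k _; rewrite mxE mulr0.
- by rewrite block_mxEur lr.
- have /matrixP/(_ (lshift N j) (rshift N i)) := form_A_skew ext_lie x.
  by rewrite block_mxEdl mxE [in RHS]mxE lr => ->; rewrite !mxE.
by rewrite block_mxEdr mxE rb rb /= /ext_br !row_mxKl regular_mx0 trmx0 !mulmx0 subr0 row_mx0 mxE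
    /pairing big1 // => k _; rewrite mxE mulr0.
Qed.

(** Meaningful for [i < nth 0 ms b] only: beyond that the position falls into a later block or, past
    the end, gives 0. *)
Definition block_coord x b i : C := oapp (x 0) 0 (insub (flatten_index ms b i)).

Lemma block_coordE x r b i : ord_block r = b -> ord_offset r = i -> block_coord x b i = x 0 r.
Proof. by move=> <- <-; rewrite /block_coord /ord_block /ord_offset reshape_indexK valK. Qed.

(** Inside one block, multiplication by [x] is a triangular Toeplitz matrix formed from the
    component of [x] in the head block. *)
Lemma regular_mx_same x r d : ord_block r = ord_block d -> (ord_offset r <= ord_offset d)%N ->
  regular_mx x r d = block_coord x (hd (ord_block d)) (ord_offset d - ord_offset r).
Proof.
move=> rd ord; have [e eB eo] : exists2 e, ord_block e = hd (ord_block d) &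
    ord_offset e = (ord_offset d - ord_offset r)%N.
  by apply: exists_ord; have h1 := ord_offset_lt d; have h2 := leq_nth_hd (ord_block_lt d); lia.
rewrite (block_coordE x eB eo) mxE (bigD1 e) //= big1 ?addr0 => [|e' e'e].
  rewrite /basis_mul eB eo rd eqxx orbC eqxx /=.
  by rewrite subnKC // eqxx mulr1.
case: (boolP (basis_mul r e' d)) => [/andP[/eqP o B]|_]; last by rewrite mulr0.
case/eqP: e'e; apply: ord_block_offset_inj; last by lia.
by case/orP: B => /andP[/eqP B1 /eqP B2]; congruence.
Qed.

Lemma regular_mx_neq0 x r d : regular_mx x r d != 0 -> exists e, basis_mul r e d.
Proof.
move=> rd; apply/existsP; apply: contraNT rd; rewrite negb_exists => /forallP nT.
by rewrite mxE big1 // => e _; rewrite (negPf (nT e)) mulr0.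
Qed.

Lemma ord_leE r d : (r <= d)%N =
  (ord_block r < ord_block d)%N || ((ord_block r == ord_block d) && (ord_offset r <= ord_offset d)%N).
Proof. exact: reshape_leq. Qed.

Lemma regular_mx_le x r d : regular_mx x r d != 0 -> (r <= d)%N.
Proof.
case/regular_mx_neq0 => e /andP[/eqP o B]; rewrite ord_leE.
have ord : (ord_offset r <= ord_offset d)%N by lia.
case/orP: B => /andP[] => [/eqP -> _|_ /eqP ->]; last by rewrite eqxx ord orbT.
by rewrite ord andbT orbC -leq_eqVlt hd_le ?ord_block_lt.
Qed.

Lemma unit_upper (A : 'M[C]_N) :
  (forall r d, A r d != 0 -> (r <= d)%N) -> (forall r, A r r != 0) -> A \in unitmx.
Proof.
move=> Aup Adiag; rewrite unitmxE -det_tr det_trig ?unitfE.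
  by apply/prodf_neq0 => r _; rewrite mxE.
apply/is_trig_mxP => r d rd; rewrite mxE; apply: contraTeq rd => /Aup.
by rewrite -leqNgt.
Qed.

Lemma regular_mx_unit a : (forall b, (b < size ms)%N -> block_coord a (hd b) 0 != 0) ->
  regular_mx a \in unitmx.
Proof.
move=> a0; apply: unit_upper => [r d|r]; first exact: regular_mx_le.
by rewrite regular_mx_same // subnn a0 ?ord_block_lt.
Qed.

Lemma block_coord_mul0 x a b : (b < size ms)%N -> hd b = b ->
  block_coord (x *m regular_mx a) b 0 = block_coord x b 0 * block_coord a b 0.
Proof.
move=> bs hb; have [d dB do_] := exists_ord (ms_pos bs).
rewrite !(block_coordE _ dB do_) mxE (bigD1 d) //= big1 ?addr0 => [|r rd].
  by rewrite regular_mx_same // subnn dB hb (block_coordE _ dB do_).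
case: (eqVneq (regular_mx a r d) 0) => [->|/regular_mx_neq0[e /andP[/eqP o B]]]; first by rewrite mulr0.
case/eqP: rd; apply: ord_block_offset_inj; last by lia.
by case/orP: B => /andP[] => [/eqP -> _|_ /eqP -> //]; rewrite dB hb.
Qed.

Lemma block_coord_mul1 x a b : (b < size ms)%N -> (1 < nth 0 ms b)%N -> hd b = b ->
  block_coord (x *m regular_mx a) b 1 =
    block_coord x b 0 * block_coord a b 1 + block_coord x b 1 * block_coord a b 0.
Proof.
move=> bs mb hb; have [d dB do_] := exists_ord mb.
have [d' d'B d'o] := exists_ord (ltnW mb).
rewrite !(block_coordE _ dB do_) mxE (bigD1 d) //= (bigD1 d') /=; last first.
  by apply/eqP => dd'; rewrite dd' do_ in d'o.
rewrite big1 ?addr0 => [|r /andP[rd rd']].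
  rewrite !regular_mx_same ?dB ?d'B ?do_ ?d'o // hb subnn subn0 addrC.
  by rewrite !(block_coordE _ d'B d'o) !(block_coordE _ dB do_).
case: (eqVneq (regular_mx a r d) 0) => [->|/regular_mx_neq0[e /andP[/eqP o B]]]; first by rewrite mulr0.
have rB : ord_block r = b by case/orP: B => /andP[] => [/eqP -> _|_ /eqP -> //]; rewrite dB hb.
case E : (ord_offset r) => [|[|k]]; last by lia.
  by case/eqP: rd'; apply: ord_block_offset_inj; rewrite ?rB ?E.
by case/eqP: rd; apply: ord_block_offset_inj; rewrite ?rB ?E.
Qed.

(** * Jordan chains of a generic multiplication *)

Section JordanChains.
Variable c : 'rV[C]_N.

Definition chain_eig b : C := block_coord c (hd b) 0.
Definition chain_nilp b : 'M[C]_N := regular_mx c - (chain_eig b)%:M.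
Definition jordan_chain b i : 'rV[C]_N :=
  iter i (mulmxr (chain_nilp b)) (\row_r (val r == flatten_index ms b 0)%:R).

(** Bounds the support of [jordan_chain b i]. Each step raises the offset, except that passing from
    a head block [b] to another block of its tuple may leave it unchanged. This happens at most
    once, as those blocks have trivial products; hence the lag by one. *)
Let supp b i r : bool := (ord_block r == b) && (i <= ord_offset r)%N ||
  [&& ord_block r != b, hd (ord_block r) == b & (i <= (ord_offset r).+1)%N].

Let hd_supp b i r : (b < size ms)%N -> supp b i r -> hd (ord_block r) = hd b.
Proof.
by move=> bs /orP[/andP[/eqP -> //]|/and3P[_ /eqP <- _]]; rewrite hdK ?ord_block_lt.
Qed.

Let nilp_neq0 b i r d : (b < size ms)%N -> supp b i r -> chain_nilp b r d != 0 ->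
  [/\ r != d, exists e, basis_mul r e d & chain_nilp b r d = regular_mx c r d].
Proof.
move=> bs sr; have nE : chain_nilp b r d = regular_mx c r d - chain_eig b *+ (r == d) by rewrite /chain_nilp !mxE.
rewrite nE; have [rd|rd] := eqVneq r d; last by rewrite subr0 => /regular_mx_neq0.
by rewrite -rd regular_mx_same // subnn (hd_supp bs sr) subrr eqxx.
Qed.

Let supp_step b i r d : (b < size ms)%N -> supp b i r -> chain_nilp b r d != 0 ->
  supp b i.+1 d /\ (ord_block d = b -> ord_block r = b /\ (ord_offset r < ord_offset d)%N).
Proof.
move=> bs sr /(nilp_neq0 bs sr)[rd [e /andP[/eqP o B]] _].
have rd_same : ord_block r = ord_block d -> (ord_offset r < ord_offset d)%N.
  move=> rdB; rewrite ltn_neqAle -{2}o leq_addr andbT.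
  by apply: contra rd => /eqP ro; apply/eqP; apply: ord_block_offset_inj.
case/orP: sr => [/andP[/eqP rb ir]|/and3P[rb /eqP hr ir]].
  have [db|db] := eqVneq (ord_block d) b.
    have lt_rd := rd_same (etrans rb (esym db)).
    by split=> //; rewrite /supp db eqxx (leq_ltn_trans ir lt_rd).
  split; last by move/eqP: db.
  case/orP: B => /andP[] => [/eqP rhd _|_ /eqP rd']; last by rewrite -rd' rb eqxx in db.
  by rewrite /supp db -rhd rb eqxx /=; apply/orP; right; rewrite ltnS -o; lia.
have rd' : ord_block r = ord_block d.
  case/orP: B => /andP[] => [/eqP rhd _|_ /eqP //].
  by move: rb; rewrite -hr rhd hd_ord_block eqxx.
split; last by move=> db; rewrite rd' db eqxx in rb.
rewrite /supp -rd' rb hr eqxx /=; apply/orP; right.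
by have h := rd_same rd'; lia.
Qed.

Let chain0E b r : (b < size ms)%N -> jordan_chain b 0 0 r = ((ord_block r == b) && (ord_offset r == 0%N))%:R.
Proof.
move=> bs; rewrite /jordan_chain /= mxE; congr (_%:R); congr nat_of_bool.
apply/eqP/andP => [rE|[/eqP <- /eqP ro]]; last by rewrite -ro reshape_indexK.
have mb := ms_pos bs.
by rewrite /ord_block /ord_offset rE flatten_indexKl // flatten_indexKr // !eqxx.
Qed.

Let chainS b i : jordan_chain b i.+1 = jordan_chain b i *m chain_nilp b.
Proof. by rewrite /jordan_chain iterS. Qed.

Let chain_supp b i r : (b < size ms)%N -> jordan_chain b i 0 r != 0 -> supp b i r.
Proof.
move=> bs; elim: i r => [|i IH] d.
  by rewrite chain0E // /supp; case: (ord_block d == b); rewrite ?eqxx.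
rewrite chainS mxE => /eqP nz; case: (boolP (supp b i.+1 d)) => // nd.
case: nz; apply: big1 => r _; have [->|/IH sr] := eqVneq (jordan_chain b i 0 r) 0.
  by rewrite mul0r.
have [->|/(supp_step bs sr)[sd _]] := eqVneq (chain_nilp b r d) 0; first by rewrite mulr0.
by rewrite sd in nd.
Qed.

(** Offset [i] of block [b] is reached in [i] steps only by gaining one each time, which contributes
    the linear coefficient of [c]. *)
Let chain_lead b i r : (b < size ms)%N -> ord_block r = b -> ord_offset r = i ->
  jordan_chain b i 0 r = block_coord c (hd b) 1 ^+ i.
Proof.
move=> bs rb; elim: i r rb => [|i IH] r rb ro.
  by rewrite chain0E // rb ro !eqxx.
have [r' r'b r'o] : exists2 r', ord_block r' = b & ord_offset r' = i.
  by apply: exists_ord; have := ord_offset_lt r; rewrite rb ro => h; lia.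
rewrite chainS mxE (bigD1 r') //= big1 ?addr0 => [|d dr'].
  rewrite IH // exprSr; congr (_ * _).
  have -> : chain_nilp b r' r = regular_mx c r' r.
    rewrite /chain_nilp !mxE; case: eqP => [E|_]; last by rewrite subr0.
    by move: ro; rewrite -E r'o; lia.
  by rewrite regular_mx_same ?rb ?r'b // ro r'o ?subSnn.
have [->|/(chain_supp bs) sd] := eqVneq (jordan_chain b i 0 d) 0; first by rewrite mul0r.
have [->|/(supp_step bs sd)[_ /(_ rb)[db dlt]]] := eqVneq (chain_nilp b d r) 0.
  by rewrite mulr0.
case/eqP: dr'; apply: ord_block_offset_inj; first by rewrite db r'b.
by case/orP: sd => /andP[]; rewrite db eqxx // => _; lia.
Qed.

(* The maximum of a tuple being unique, [chain_nilp] kills the end of the main chain. *)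
Let chain_end b : (b < size ms)%N -> jordan_chain b (nth 0 ms b) = 0.
Proof.
move=> bs; apply/rowP => r; rewrite [RHS]mxE; apply/eqP; apply: contraT => /(chain_supp bs).
have ro := ord_offset_lt r; case/orP => [/andP[/eqP rb le]|/and3P[rb /eqP hr le]].
  by move: le; rewrite -rb leqNgt ro.
have := hd_size (ord_block_lt r); rewrite hr eq_sym => /(_ rb) lt.
by have := leq_trans lt le; rewrite ltnS leqNgt ro.
Qed.

Definition chain_mx : 'M[C]_N := \matrix_(r < N) jordan_chain (ord_block r) (ord_offset r).

Lemma chain_mx_unit :
    (forall b, (b < size ms)%N -> (1 < nth 0 ms b)%N -> block_coord c (hd b) 1 != 0) ->
  chain_mx \in unitmx.
Proof.
move=> c1; apply: unit_upper => [r d|r].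
  rewrite mxE => /(chain_supp (ord_block_lt r)) /orP[/andP[/eqP db ord]|/and3P[dr hd_d _]].
    by rewrite ord_leE db eqxx ord orbT.
  rewrite ord_leE; apply/orP; left; rewrite ltn_neqAle -{2}(eqP hd_d) eq_sym dr.
  exact/hd_le/ord_block_lt.
rewrite mxE chain_lead ?ord_block_lt //; have := ord_offset_lt r; case: (ord_offset r) => [|i] lt.
  by rewrite expr0 oner_neq0.
by rewrite expf_neq0 // c1 ?ord_block_lt //; apply: leq_ltn_trans lt.
Qed.

(** The sum has one term inside a chain and none at its end, where [chain_end] applies. *)
Lemma chain_mx_mul r : row r chain_mx *m regular_mx c = chain_eig (ord_block r) *: row r chain_mx +
  \sum_(r' | (ord_block r' == ord_block r) && (ord_offset r' == (ord_offset r).+1)) row r' chain_mx.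
Proof.
rewrite rowK -[regular_mx c](subrK (chain_eig (ord_block r))%:M) mulmxDr mul_mx_scalar addrC; congr (_ + _).
rewrite -/(chain_nilp _) -chainS; have [lt|ge] := ltnP (ord_offset r).+1 (nth 0 ms (ord_block r)).
  have [r' r'b r'o] := exists_ord lt; rewrite (big_pred1 r') => [|d].
    by rewrite rowK r'b r'o.
  apply/andP/eqP => [[/eqP db /eqP do_]|->]; last by rewrite r'b r'o !eqxx.
  by apply: ord_block_offset_inj; rewrite ?r'b ?r'o.
have -> : (ord_offset r).+1 = nth 0 ms (ord_block r) by apply/eqP; rewrite eqn_leq ge ord_offset_lt.
rewrite chain_end ?ord_block_lt // big1 // => d /andP[/eqP db /eqP do_].
by have := ord_offset_lt d; rewrite do_ db ltnn.
Qed.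

End JordanChains.

Definition ext_blocks (e : nat -> C) : seq jkblock :=
  [seq JKJordan (Some (e b)) (nth 0 ms b) | b <- iota 0 (size ms)].

Lemma shape_ext_blocks e : shape_of (ext_blocks e) = [seq 2 * m | m <- ms]%N.
Proof.
rewrite /shape_of -map_comp; apply: (@eq_from_nth _ 0%N); rewrite !size_map size_iota // => b bs.
by rewrite (nth_map 0%N) ?size_iota // nth_iota // (nth_map 0%N).
Qed.

Lemma sumn_shape_ext e : sumn (shape_of (ext_blocks e)) = (N + N)%N.
Proof.
rewrite shape_ext_blocks; have E l : sumn [seq 2 * m | m <- l]%N = (sumn l + sumn l)%N.
  by elim: l => //= m l ->; lia.
exact: E.
Qed.

(** [P] has to serve both forms, hence the quantification over [X] after it. It is the base change
    diag(E, F) followed by a permutation that gathers, for each block, its vectors of the first half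
    and then those of the second. *)
Lemma ext_congruence (e : nat -> C) (E F : 'M[C]_N) :
    E \in unitmx -> F \in unitmx ->
  exists2 P : 'M_(N + N), P \in unitmx &
    forall (X : 'M_N) f (ent : nat -> nat -> nat -> C),
    (forall r r', (E *m X *m F^T) r r' =
       if ord_block r == ord_block r' then ent (ord_block r) (ord_offset r) (ord_offset r') else 0) ->
    (forall b, f (JKJordan (Some (e b)) (nth 0 ms b)) = skew_of (nth 0 ms b) (ent b)) ->
  P *m block_mx 0 X (- X^T) 0 *m P^T = blockdiag_mx (N + N) f (ext_blocks e).
Proof.
move=> Eu Fu; pose sh := shape_of (ext_blocks e).
pose B (k : 'I_(N + N)) := reshape_index sh k; pose O (k : 'I_(N + N)) := reshape_offset sh k.
have k_lt (k : 'I_(N + N)) : (k < sumn sh)%N by rewrite /sh sumn_shape_ext.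
have Bs k : (B k < size ms)%N.
  have <- : size sh = size ms by rewrite /sh shape_ext_blocks size_map.
  exact/reshape_indexP/k_lt.
have nth_sh b : (b < size ms)%N -> nth 0 sh b = (2 * nth 0 ms b)%N.
  by move=> bs; rewrite /sh shape_ext_blocks (nth_map 0%N).
have Om k : (O k < 2 * nth 0 ms (B k))%N by rewrite -nth_sh ?Bs // reshape_offsetP.
have /fin_all_exists[sig sigE] : forall k, exists k' : 'I_(N + N),
    exists2 r, ord_block r = B k & if (O k < nth 0 ms (B k))%N
    then ord_offset r = O k /\ k' = lshift N r
    else ord_offset r = (O k - nth 0 ms (B k))%N /\ k' = rshift N r.
  move=> k; have Ok := Om k; case: ltnP => lt.
    by have [r rB ro] := exists_ord lt; exists (lshift N r); exists r.
  have lt' : (O k - nth 0 ms (B k) < nth 0 ms (B k))%N by clear -lt Ok; lia.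
  by have [r rB ro] := exists_ord lt'; exists (rshift N r); exists r.
have sig_inj : injective sig.
  move=> k k' kk'; suff [BB OO] : B k = B k' /\ O k = O k'.
    by apply: val_inj; rewrite /= -(reshape_indexK sh k) -/(B k) -/(O k) BB OO reshape_indexK.
  have [r rB rP] := sigE k; have [r' r'B r'P] := sigE k'; move: rP r'P; rewrite kk'.
  case: ifP => lt [ro rk]; case: ifP => lt' [r'o]; rewrite rk.
  - by move/lshift_inj => rr'; rewrite -rB -r'B -ro -r'o rr'.
  - by move/eqP; rewrite eq_lrshift.
  - by move/eqP; rewrite eq_rlshift.
  move/rshift_inj => rr'; have BB : B k = B k' by rewrite -rB -r'B rr'.
  split=> //; move: lt lt' ro r'o; rewrite rr' BB => lt lt' -> ; lia.
pose Z : 'M[C]_(N + N) := block_mx E 0 0 F.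
exists (row_perm (perm sig_inj) Z) => [|X f ent XE fE].
  rewrite row_permE unitmx_mul unitmx_perm /= unitmxE det_ublock unitrM.
  by rewrite -!unitmxE Eu Fu.
apply/matrixP => k k'; rewrite [RHS]mxE.
have -> (A : 'M[C]_(N + N)) : (row_perm (perm sig_inj) Z *m A *m
    (row_perm (perm sig_inj) Z)^T) k k' = (Z *m A *m Z^T) (sig k) (sig k').
  rewrite !mxE; apply: eq_bigr => i _; rewrite !mxE permE; congr (_ * _).
  by apply: eq_bigr => j _; rewrite !mxE permE.
rewrite /Z tr_block_mx !mulmx_block !trmx0 !(mulmx0, mul0mx, add0r, addr0).
rewrite -(reshape_indexK sh k) -(reshape_indexK sh k') -!/(B _) -!/(O _).
rewrite blockdiag_flatten -/sh ?nth_sh ?Bs ?Om //.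
rewrite (nth_map 0%N) ?size_iota ?Bs // nth_iota ?Bs // add0n fE.
have [r rB rP] := sigE k; have [r' r'B r'P] := sigE k'; move: rP r'P.
case: ltnP => lt [ro ->]; case: ltnP => lt' [r'o ->].
- rewrite block_mxEul mxE; case: eqP => // BB.
  by rewrite /skew_of [(_ <= O k)%N]leqNgt lt /= leqNgt BB lt'.
- rewrite block_mxEur XE rB r'B ro r'o; case: eqP => // BB.
  by rewrite /skew_of lt BB lt'.
- rewrite block_mxEdl mulmxN mulNmx mxE.
  have -> : (F *m X^T *m E^T) r r' = (E *m X *m F^T) r' r.
    have -> : F *m X^T *m E^T = (E *m X *m F^T)^T by rewrite !trmx_mul trmxK mulmxA.
    by rewrite mxE.
  rewrite XE rB r'B ro r'o [B k' == _]eq_sym; case: eqP => [BB|_]; last by rewrite oppr0.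
  by rewrite /skew_of ltnNge lt /= BB lt'.
rewrite block_mxEdr mxE; case: eqP => // BB.
by rewrite /skew_of [(O k < _)%N]ltnNge lt /= BB [(O k' < _)%N]ltnNge lt'.
Qed.

Lemma ext_JK (x a : 'rV[C]_(N + N)) (c : 'rV[C]_N) :
    c *m regular_mx (rsubmx a) = rsubmx x ->
    (forall b, (b < size ms)%N -> block_coord (rsubmx a) (hd b) 0 != 0) ->
    (forall b, (b < size ms)%N -> (1 < nth 0 ms b)%N -> block_coord c (hd b) 1 != 0) ->
  JK_decomposition (form_A ext_lie x) (form_A ext_lie a) (ext_blocks (chain_eig c)).
Proof.
move=> cx a0 c1; split; [|split].
- apply/(all_nthP (JKKron 0)) => b; rewrite size_map size_iota => bs.
  by rewrite (nth_map 0%N) ?size_iota // nth_iota // add0n /= ms_pos.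
- by rewrite -sumn_shape_of sumn_shape_ext.
pose E := chain_mx c; pose La := regular_mx (rsubmx a).
have Eu : E \in unitmx := chain_mx_unit c1.
have Gu : E *m La \in unitmx by rewrite unitmx_mul Eu regular_mx_unit.
(* This choice makes the second form the identity; the first then becomes the matrix of
   multiplication by c = x / a in the basis of chains. *)
pose F := (invmx (E *m La))^T.
have Fu : F \in unitmx by rewrite unitmx_tr unitmx_inv.
have EF : E *m La *m F^T = 1%:M by rewrite trmxK mulmxV.
pose J : 'M[C]_N := \matrix_(r, r') (chain_eig c (ord_block r) * (r == r')%:R +
  ((ord_block r' == ord_block r) && (ord_offset r' == (ord_offset r).+1))%:R).
have EJ : E *m regular_mx c = J *m E.
  apply/row_matrixP => r; rewrite !row_mul chain_mx_mul mulmx_sum_row.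
  rewrite [RHS](eq_bigr (fun r' => (chain_eig c (ord_block r) * (r == r')%:R) *: row r' E +
    ((ord_block r' == ord_block r) && (ord_offset r' == (ord_offset r).+1))%:R *: row r' E)) => [|r' _].
    rewrite big_split /=; congr (_ + _).
      rewrite (bigD1 r) //= eqxx mulr1 big1 ?addr0 // => r' /negPf rr'.
      by rewrite eq_sym rr' mulr0 scale0r.
    rewrite [RHS](bigID (fun r' => (ord_block r' == ord_block r) && (ord_offset r' == (ord_offset r).+1))) /=.
    rewrite [X in _ = _ + X]big1 ?addr0 => [|r' /negPf ->]; last by rewrite scale0r.
    by apply: eq_bigr => r' ->; rewrite scale1r.
  by rewrite !mxE scalerDl.
have EX : E *m regular_mx (rsubmx x) *m F^T = J.
  by rewrite -cx regular_mx_mul mulmxA EJ -!mulmxA [E *m _]mulmxA EF mulmx1.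
have [P Pu PP] := ext_congruence (chain_eig c) Eu Fu; exists P; split=> //; rewrite !form_ext.
have eqE r r' : (r == r') = (ord_block r == ord_block r') && (ord_offset r == ord_offset r').
  by apply/eqP/andP => [->|[/eqP B /eqP O]]; [rewrite !eqxx | apply: ord_block_offset_inj].
split.
  apply: (PP _ _ (fun b => jordan_entry (chain_eig c b))) => // r r'.
  rewrite EX mxE eqE [ord_block r' == _]eq_sym; case: eqP => _ /=; last by rewrite mulr0 addr0.
  rewrite /jordan_entry; case: eqP => [->|_].
    by rewrite mulr1 -[(ord_offset r').+1]addn1 -{1}[ord_offset r']addn0 eqn_add2l addr0.
  by rewrite mulr0 add0r; case: eqP.
apply: (PP _ _ (fun b => id_entry)) => // r r'.
by rewrite EF mxE eqE /id_entry; case: eqP => //= _; case: eqP.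
Qed.

Lemma hd_lt b : (b < size ms)%N -> (hd b < size ms)%N.
Proof. by move=> bs; apply: leq_ltn_trans (hd_le bs) bs. Qed.

Lemma hd_gt1 b : (b < size ms)%N -> (1 < nth 0 ms b)%N -> (1 < nth 0 ms (hd b))%N.
Proof. by move=> bs b1; apply: leq_trans b1 (leq_nth_hd bs). Qed.

Lemma ext_generic : exists f : {mpoly C[(N + N) + (N + N)]},
  (exists x a : 'rV_(N + N), meval (point x a) f != 0) /\
  forall x a : 'rV_(N + N), meval (point x a) f != 0 -> exists e,
    JK_decomposition (form_A ext_lie x) (form_A ext_lie a) (ext_blocks e) /\
    forall b b', (b < size ms)%N -> (b' < size ms)%N -> (e b == e b') = (hd b == hd b').
Proof.
pose var (v : 'I_(N + N) -> 'I_((N + N) + (N + N))) b i : {mpoly C[(N + N) + (N + N)]} :=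
  oapp (fun r : 'I_N => 'X_(v (rshift N r))) 0 (insub (flatten_index ms b i)).
pose px := var (@lshift (N + N) (N + N)); pose pa := var (@rshift (N + N) (N + N)).
have pxE (x a : 'rV_(N + N)) b i : meval (point x a) (px b i) = block_coord (rsubmx x) b i.
  rewrite /px /var /block_coord; case: insubP => [r _ _|_] /=; last by rewrite meval0.
  by rewrite mevalXU /point row_mxEl mxE.
have paE (x a : 'rV_(N + N)) b i : meval (point x a) (pa b i) = block_coord (rsubmx a) b i.
  rewrite /pa /var /block_coord; case: insubP => [r _ _|_] /=; last by rewrite meval0.
  by rewrite mevalXU /point row_mxEr mxE.
(* The factors express that [a] is invertible, that the eigenvalues x_0 / a_0 of different tuples
   differ, and that the linear coefficient (x_1 a_0 - x_0 a_1) / a_0^2 of x / a is nonzero in the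
   heads of blocks longer than one. *)
exists ((\prod_(b < size ms) pa (hd b) 0%N) *
  (\prod_(b < size ms) \prod_(b' < size ms | hd b != hd b')
    (px (hd b) 0%N * pa (hd b') 0%N - px (hd b') 0%N * pa (hd b) 0%N)) *
  (\prod_(b < size ms | (1 < nth 0 ms b)%N)
    (px (hd b) 1%N * pa (hd b) 0%N - px (hd b) 0%N * pa (hd b) 1%N))).
split.
  (* The witness for [a] has constant coefficients 1 and no linear ones; the witness for [x] has
     constant coefficient b in block b, so different heads are told apart, and linear coefficients
     1. *)
  pose y : 'rV[C]_N := \row_r (ord_offset r == 0%N)%:R.
  pose z : 'rV[C]_N := \row_r (if ord_offset r == 0%N then (ord_block r)%:R else (ord_offset r == 1%N)%:R).
  exists (row_mx 0 z), (row_mx 0 y).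
  have y0 b : (b < size ms)%N -> block_coord y b 0 = 1.
    by move=> bs; have [r rb ro] := exists_ord (ms_pos bs); rewrite (block_coordE _ rb ro) mxE ro.
  have z0 b : (b < size ms)%N -> block_coord z b 0 = b%:R.
    by move=> bs; have [r rb ro] := exists_ord (ms_pos bs); rewrite (block_coordE _ rb ro) mxE ro rb.
  have y1 b : (1 < nth 0 ms b)%N -> block_coord y b 1 = 0.
    by move=> b1; have [r rb ro] := exists_ord b1; rewrite (block_coordE _ rb ro) mxE ro.
  have z1 b : (1 < nth 0 ms b)%N -> block_coord z b 1 = 1.
    by move=> b1; have [r rb ro] := exists_ord b1; rewrite (block_coordE _ rb ro) mxE ro.
  rewrite !mevalM !rmorph_prod !mulf_neq0 //.
  - by apply/prodf_neq0 => b _; rewrite /= paE row_mxKr y0 ?oner_neq0 ?hd_lt.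
  - apply/prodf_neq0 => b _; rewrite /= rmorph_prod; apply/prodf_neq0 => b' bb'.
    rewrite /= mevalB !mevalM !pxE !paE !row_mxKr !y0 ?z0 ?hd_lt // !mulr1.
    by rewrite subr_eq0; apply: contra bb' => /eqP/C_natr_inj ->.
  apply/prodf_neq0 => b b1; rewrite /= mevalB !mevalM !pxE !paE !row_mxKr.
  have hb1 := hd_gt1 (ltn_ord b) b1.
  by rewrite z1 // y1 // y0 ?hd_lt // mulr0 subr0 mulr1 oner_neq0.
move=> x a; rewrite !mevalM !rmorph_prod !mulf_eq0 !negb_or -andbA.
case/and3P=> /prodf_neq0 a0 /prodf_neq0 x0 /prodf_neq0 x1.
have {}a0 b : (b < size ms)%N -> block_coord (rsubmx a) (hd b) 0 != 0.
  by move=> bs; have := a0 (Ordinal bs) isT; rewrite /= paE.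
have Lu := regular_mx_unit a0.
pose c := rsubmx x *m invmx (regular_mx (rsubmx a)).
have cx : c *m regular_mx (rsubmx a) = rsubmx x by rewrite mulmxKV.
have x0E b : (b < size ms)%N ->
    block_coord (rsubmx x) (hd b) 0 = block_coord c (hd b) 0 * block_coord (rsubmx a) (hd b) 0.
  by move=> bs; rewrite -cx block_coord_mul0 ?hd_lt ?hdK.
exists (chain_eig c); split.
  apply: ext_JK => // b bs b1.
  have := x1 (Ordinal bs) b1; rewrite /= mevalB !mevalM !pxE !paE /= x0E // -cx.
  rewrite block_coord_mul1 ?hd_lt ?hdK // ?hd_gt1 //; apply: contraNneq => ->; apply/eqP; ring.
move=> b b' bs b's; rewrite /chain_eig.
have [->|hh] := eqVneq (hd b) (hd b'); first by rewrite eqxx.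
apply/negbTE; have := x0 (Ordinal bs) isT; rewrite /= rmorph_prod => /prodf_neq0.
move=> /(_ (Ordinal b's) hh); rewrite /= mevalB !mevalM !pxE !paE /= !x0E //.
by apply: contraNneq => ->; apply/eqP; ring.
Qed.

End Construction.

(** * The given tuples as blocks of the construction *)

Section Sufficiency.
Variable ns : seq (seq nat).
Hypothesis ns_tuple : forall t, t \in ns ->
  [/\ t != [::], all (fun k => 0 < k)%N t & sorted geq t].
Hypothesis ns_max : forall t, t \in ns -> size t = 1%N \/ (nth 0 t 1 < nth 0 t 0)%N.

Let ms := flatten ns.
Let sh := shape ns.
Let tup b := reshape_index sh b.
Let start i := flatten_index sh i 0.
(** First position of the tuple containing [b]; as tuples are sorted, it carries the maximum. *)
Let hd b := start (tup b).

Let size_ms : size ms = sumn sh. Proof. exact: size_flatten. Qed.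

Let size_sh : size sh = size ns. Proof. exact: size_map. Qed.

Let nth_sh i : nth 0 sh i = size (nth [::] ns i).
Proof.
have [lt|ge] := ltnP i (size ns); first by rewrite (nth_map [::]).
by rewrite !nth_default // size_sh.
Qed.

Let sh_pos i : (i < size ns)%N -> (0 < nth 0 sh i)%N.
Proof.
move=> lt; rewrite nth_sh lt0n size_eq0.
by have [] := ns_tuple (mem_nth [::] lt).
Qed.

Let tup_lt b : (b < size ms)%N -> (tup b < size ns)%N.
Proof. by rewrite size_ms -size_sh; apply: reshape_indexP. Qed.

Let tup_start i : (i < size ns)%N -> tup (start i) = i.
Proof. by move=> lt; rewrite /tup flatten_indexKl ?sh_pos. Qed.

Let start_lt i : (i < size ns)%N -> (start i < size ms)%N.
Proof. by move=> lt; rewrite size_ms flatten_indexP ?sh_pos. Qed.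

Let nth_ms i j : (j < nth 0 sh i)%N ->
  nth 0 ms (flatten_index sh i j) = nth 0 (nth [::] ns i) j.
Proof. by move=> lt; rewrite nth_flatten flatten_indexKl // flatten_indexKr. Qed.

Let geq_trans : transitive geq.
Proof. by move=> x y z yx zy; apply: leq_trans yx. Qed.

Let hdK b : (b < size ms)%N -> hd (hd b) = hd b.
Proof. by move=> bs; rewrite /hd tup_start ?tup_lt. Qed.

Let hd_le b : (b < size ms)%N -> (hd b <= b)%N.
Proof.
move=> bs; rewrite -{2}(reshape_indexK sh b) /hd /start /flatten_index.
by rewrite leq_add2l.
Qed.

Let ms_pos b : (b < size ms)%N -> (0 < nth 0 ms b)%N.
Proof.
move=> bs; have /flattenP[t tns bt] := mem_nth 0 bs.
by have [_ /allP/(_ _ bt)] := ns_tuple tns.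
Qed.

Let hd_size b : (b < size ms)%N -> hd b != b -> (nth 0 ms b < nth 0 ms (hd b))%N.
Proof.
move=> bs hb; have lt := tup_lt bs; rewrite /hd /start nth_ms ?sh_pos //.
have ob : (reshape_offset sh b < nth 0 sh (tup b))%N by apply: reshape_offsetP; rewrite -size_ms.
have bE : flatten_index sh (tup b) (reshape_offset sh b) = b := reshape_indexK sh b.
rewrite -{1}bE nth_ms //; move: ob; rewrite nth_sh.
have tns := mem_nth [::] lt; have [_ _ tsort] := ns_tuple tns; set t := nth _ ns _ in tns tsort *.
case E : (reshape_offset sh b) => [|o] ob.
  by move: hb; rewrite -[X in _ != X]bE E eqxx.
case: (ns_max tns) => [t1|]; first by rewrite t1 in ob.
apply: leq_ltn_trans.
apply: (sorted_leq_nth geq_trans (@leqnn) 0 tsort) => //; rewrite inE //.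
by apply: leq_ltn_trans ob.
Qed.

Section Tuples.
Variable e : nat -> C.
Hypothesis eE : forall b b', (b < size ms)%N -> (b' < size ms)%N ->
  (e b == e b') = (hd b == hd b').
Let s := ext_blocks ms e.

Lemma ext_kron_sizes : kron_sizes s = [::].
Proof. by rewrite /kron_sizes /s /ext_blocks; elim: (iota _ _). Qed.

Let tuple_indices i : (i < size ns)%N ->
  [seq b <- iota 0 (size ms) | tup b == i] = iota (start i) (size (nth [::] ns i)).
Proof.
move=> lt; apply: (irr_sorted_eq ltn_trans ltnn).
- by apply: sorted_filter; [exact: ltn_trans | exact: iota_ltn_sorted].
- exact: iota_ltn_sorted.
move=> b; rewrite mem_filter !mem_iota add0n leq0n /=; apply/andP/andP.
  case=> /eqP <- bs.
  have ob : (reshape_offset sh b < size (nth [::] ns (tup b)))%N.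
    by rewrite -nth_sh reshape_offsetP -?size_ms.
  have bE : b = (start (tup b) + reshape_offset sh b)%N.
    by rewrite /start /flatten_index addn0 -[LHS](reshape_indexK sh b).
  by split; lia.
case=> le lt'; have bE : b = flatten_index sh i (b - start i).
  by rewrite /flatten_index -[sumn _]addn0 -/(start i) subnKC.
have lt'' : (b - start i < nth 0 sh i)%N by rewrite nth_sh; lia.
by rewrite bE /tup flatten_indexKl // eqxx size_ms flatten_indexP.
Qed.

(** By [eE] exactly the blocks of one tuple share its eigenvalue; they are consecutive and already
    sorted. *)
Lemma ext_jordan_tuple i : (i < size ns)%N ->
  jordan_tuple s (Some (e (start i))) = [seq 2 * k | k <- nth [::] ns i]%N.
Proof.
move=> lt; have [_ _ tsort] := ns_tuple (mem_nth [::] lt).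
rewrite -[RHS](@sorted_sort _ geq) ?sorted_map //; last first.
  by apply: sub_sorted tsort => x y; rewrite /= leq_pmul2l.
congr sort; rewrite /s /ext_blocks filter_map -map_comp.
have -> : [seq b <- iota 0 (size ms) | Some (e b) == Some (e (start i))] =
    [seq b <- iota 0 (size ms) | tup b == i].
  apply: eq_in_filter => b; rewrite mem_iota => /andP[_ bs].
  rewrite -[LHS]/(e b == e (start i)) eE ?start_lt // /hd tup_start //.
  by apply/eqP/eqP => [/(congr1 tup)|->]; rewrite ?tup_start ?tup_lt.
rewrite tuple_indices //; apply: (@eq_from_nth _ 0%N); rewrite !size_map size_iota // => j jt.
rewrite (nth_map 0%N) ?size_iota // nth_iota // (nth_map 0%N) //=.
by rewrite -nth_ms ?nth_sh // /start /flatten_index addn0.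
Qed.

Lemma ext_jordan_tuples :
  perm_eq (jordan_tuples s) [seq [seq 2 * k | k <- t] | t <- ns]%N.
Proof.
have eigs : perm_eq (jordan_eigs s) [seq Some (e (start i)) | i <- iota 0 (size ns)].
  apply: uniq_perm; first exact: undup_uniq.
    rewrite map_inj_in_uniq ?iota_uniq // => i j; rewrite !mem_iota /= => li lj [].
    move/eqP; rewrite eE ?start_lt // /hd !tup_start // => /eqP/(congr1 tup).
    by rewrite !tup_start.
  move=> mu; rewrite /jordan_eigs mem_undup /s /ext_blocks filter_map -map_comp.
  rewrite filter_predT; apply/mapP/mapP => -[b]; rewrite mem_iota add0n => /andP[_ bs] ->.
    exists (tup b); first by rewrite mem_iota tup_lt.
    by congr Some; apply/eqP; rewrite eE ?start_lt ?tup_lt // -/(hd b) hdK.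
  by exists (start b) => //; rewrite mem_iota start_lt.
rewrite /jordan_tuples (perm_trans (perm_map _ eigs)) // -map_comp.
rewrite -[X in perm_eq _ (map _ X)](mkseq_nth [::] ns) /mkseq -map_comp.
rewrite (_ : map _ _ = [seq [seq 2 * k | k <- nth [::] ns i] | i <- iota 0 (size ns)]%N) //.
by apply/eq_in_map => i; rewrite mem_iota /= => lt; rewrite ext_jordan_tuple.
Qed.

End Tuples.

Theorem tuples_realizable : exists (n : nat) (g : lie_algebra n),
  JK_invariants g [::] [seq [seq 2 * k | k <- t] | t <- ns]%N.
Proof.
exists (sumn ms + sumn ms)%N, (ext_lie hdK hd_size).
have [f [fx fJK]] := ext_generic hdK hd_le hd_size ms_pos.
exists (fun x a => meval (point x a) f != 0); split; first by exists [:: f] => x a; rewrite /= orbF.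
split=> // x a /fJK[e [JKe eE]]; exists (ext_blocks ms e); split=> //.
by rewrite ext_kron_sizes; split=> //; apply: ext_jordan_tuples.
Qed.

End Sufficiency.

Local Close Scope ring_scope.

(* ns = [:: t_1; ...; t_p], t_i = [:: n_i1; ...; n_is_i]; the i-th Jordan
   tuple is J(2 n_i1, ..., 2 n_is_i). *)
Theorem theorem6 (ns : seq (seq nat)) :
  (forall t, t \in ns -> [/\ t != [::], all (fun k => 0 < k) t & sorted geq t]) ->
  (exists (n : nat) (g : lie_algebra n),
      JK_invariants g [::] [seq [seq 2 * k | k <- t] | t <- ns])
  <->
  (forall t, t \in ns -> size t = 1 \/ nth 0 t 1 < nth 0 t 0).
Proof.
move=> ns_tuple; split=> [[n [g JKg]] t tns|ns_max].
  have [t0 _ tsort] := ns_tuple t tns.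
  by apply: (unique_maximum JKg) => //; apply: map_f.
exact: tuples_realizable ns_tuple ns_max.
Qed.
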